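(* Let $\mathbf{Q}$ be a probability measure on $\mathfrak{N}^{\circ}(\mathbb{R})$. Then $\mathbf{Q}$ is a QSD of $Z$ if and only if, for some $\alpha\in(0,\infty)$, its probability generating functional $G_{\mathbf{Q}}$ satisfies $$G_{\mathbf{Q}}\big[G[h](\cdot)\big]-G_{\mathbf{Q}}\big[f(0)\big]=m^{\alpha}\,G_{\mathbf{Q}}[h],\quad h\in\mathcal{V}_0(\mathbb{R}).$$ (In this case $\mathbf{Q}$ is called a QSD of $Z$ with eigenvalue $m^{\alpha}$.)
   Context: Let $\mathbb{N}=\{0,1,2,\dots\}$. Let $p=\{p_j\}_{j\in\mathbb{N}}$ be a probability measure on $\mathbb{N}$ (offspring distribution) with mean $m=\sum_j jp_j$ satisfying $0<m<1$ (standing assumption) and generating function $f(s)=\sum_jp_js^j$, and let $P$ be a transition probability (Markov kernel) on $\mathbb{R}$. $\mathfrak{N}(\mathbb{R})$ is the space of finite integer-valued Borel measures (finite point measures) on $\mathbb{R}$ with the topology of weak convergence, $\mathbf{0}$ the null measure, $\mathfrak{N}^{\circ}(\mathbb{R})=\mathfrak{N}(\mathbb{R})\setminus\{\mathbf{0}\}$. $\mathcal{V}_0(\mathbb{R})$ is the set of Borel functions $h$ on $\mathbb{R}$ with $\inf h>0$ and $h\le1$. Branching Markov chain: under $\mathbb{P}_{\delta_x}$, generation $0$ consists of one particle at $x$. Each particle of generation $n$, independently of the others of its generation, is replaced after one unit of time by a random number of children with law $p$; given that the parent is at $y$, the children are positioned independently according to $P(y,\cdot)$; they form generation $n+1$.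 For $\mu=\sum_i\delta_{x_i}\in\mathfrak{N}^\circ(\mathbb{R})$, under $\mathbb{P}_\mu$ the system is the union of independent branching Markov chains started from single particles at the $x_i$. $Z_n$ is the counting measure on $\mathbb{R}$ of the positions of the particles of generation $n$, $N_n=Z_n(\mathbb{R})$, $Z=(Z_n)_{n\in\mathbb{N}}$. Probability generating functionals: $G_{\mathbf{Q}}[h]=\int \mathrm{e}^{\mu(\log h)}\,\mathbf{Q}(\mathrm{d}\mu)$ for $h\in\mathcal{V}_0(\mathbb{R})$, where $\mu(g)=\int g\,\mathrm{d}\mu$; and $G[h](x)=\mathbb{E}_{\delta_x}[\mathrm{e}^{Z_1(\log h)}]$, which maps $\mathcal{V}_0(\mathbb{R})$ into itself. In $G_{\mathbf{Q}}[f(0)]$, $f(0)$ is viewed as a constant function. QSD: a probability measure $\mathbf{Q}$ on $\mathfrak{N}^\circ(\mathbb{R})$ is a quasi-stationary distribution (QSD) of $Z$ if $(\mathbf{Q}\mathbb{P})(Z_n\in B\mid N_n>0)=\mathbf{Q}(B)$ for all $n\in\mathbb{N}$ and all Borel $B\subset\mathfrak{N}^\circ(\mathbb{R})$, where $(\mathbf{Q}\mathbb{P})(\cdot)=\int_{\mathfrak{N}^\circ(\mathbb{R})}\mathbb{P}_\mu(\cdot)\,\mathbf{Q}(\mathrm{d}\mu)$. *)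

(* Defs.v *)
From HB Require Import structures.
From mathcomp Require Import all_boot all_order all_algebra.
From mathcomp Require Import all_classical all_reals all_analysis.

Set Implicit Arguments.
Unset Strict Implicit.
Unset Printing Implicit Defensive.

Import Order.TTheory GRing.Theory Num.Theory.
Import numFieldNormedType.Exports.

Local Open Scope classical_set_scope.
Local Open Scope ring_scope.

(* A [{measure set T -> \bar R}] is a function on all sets, and its values on
   the non-measurable ones carry no information.  They are set to 0, so that
   two point measures that agree on the Borel sets are equal. *)
Section null_off.
Context d (T : measurableType d) (R : realType).
Variable mu : {measure set T -> \bar R}.

Definition null_off (A : set T) : \bar R :=
  if `[< measurable A >] then mu A else 0%E.

Let null_off0 : null_off set0 = 0%E.
Proof. by rewrite /null_off measure0; case: ifP. Qed.

Let null_off_ge0 A : (0 <= null_off A)%E.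
Proof. by rewrite /null_off; case: ifP => // _; exact: measure_ge0. Qed.

Let null_off_sigma_additive : semi_sigma_additive null_off.
Proof.
move=> F mF tF mUF; rewrite /null_off asboolT//.
under eq_fun do under eq_bigr do rewrite asboolT//.
exact: measure_semi_sigma_additive.
Qed.

HB.instance Definition _ := isMeasure.Build _ _ _ null_off
  null_off0 null_off_ge0 null_off_sigma_additive.

Lemma null_offE A : measurable A -> null_off A = mu A.
Proof. by move=> mA; rewrite /null_off asboolT. Qed.

Lemma null_off_nmeas A : ~ measurable A -> null_off A = 0%E.
Proof. by move=> mA; rewrite /null_off asboolF. Qed.

End null_off.

Record pointMeasure (R : realType) := PointMeasure {
  pm_measure :> {measure set (measurableTypeR R) -> \bar R};
  pm_natural : forall A, measurable A -> exists n : nat, pm_measure A = n%:R%:E;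
  pm_null_off : forall A, ~ measurable A -> pm_measure A = 0%E }.

Section pm_of_seq.
Context (R : realType) (s : seq R).

Let sum_dirac : set (measurableTypeR R) -> \bar R :=
  msum (fun i => dirac (nth 0 s i : measurableTypeR R)) (size s).

Let sum_dirac_natural A : measurable A ->
  exists n : nat, null_off sum_dirac A = n%:R%:E.
Proof.
move=> mA; exists (\sum_(i < size s) ((nth 0%R s i \in A) : nat))%N.
rewrite null_offE// /sum_dirac /msum natr_sum -sumEFin.
by apply: eq_bigr => i _ /=; rewrite diracE.
Qed.

(* [pm_of_seq [:: x_1; ...; x_k]] is \delta_{x_1} + ... + \delta_{x_k}. *)
Definition pm_of_seq : pointMeasure R :=
  PointMeasure sum_dirac_natural (@null_off_nmeas _ _ _ _).

Lemma pm_of_seqE A : measurable A ->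
  pm_of_seq A = (\sum_(i < size s) \d_(nth 0%R s i) A)%E.
Proof. exact: null_offE. Qed.

Lemma pm_of_seqT : pm_of_seq [set: measurableTypeR R] = (size s)%:R%:E.
Proof.
rewrite pm_of_seqE// (eq_bigr (fun=> 1%:E)) => [|i _]; last first.
  by rewrite diracE in_setT.
by rewrite sumEFin big_const_ord iter_addr_0.
Qed.

End pm_of_seq.

Definition null_pm (R : realType) : pointMeasure R := pm_of_seq [::].

Section weak_topology.
Context (R : realType).

HB.instance Definition _ := gen_eqMixin (pointMeasure R).
HB.instance Definition _ := gen_choiceMixin (pointMeasure R).
HB.instance Definition _ := isPointed.Build (pointMeasure R) (null_pm R).

Definition bounded_continuous (g : R -> R) :=
  continuous g /\ exists M : R, forall x, `|g x| <= M.

(* The coarsest topology that makes mu |-> \int g dmu continuous for every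
   bounded continuous g. *)
HB.instance Definition _ := @isSubBaseTopological.Build (pointMeasure R)
  ((R -> R) * set R)%type
  [set i | bounded_continuous i.1 /\ open i.2]
  (fun i => [set mu : pointMeasure R | i.2 (\int[mu]_x i.1 x)]).

End weak_topology.

Definition nzPointMeasure (R : realType) : Type :=
  set_type (~` [set null_pm R]).

Section nzPointMeasure.
Context (R : realType).

Lemma pm_dirac_neq0 (x : R) : pm_of_seq [:: x] \in ~` [set null_pm R].
Proof.
apply/mem_set => /= /(congr1 (fun mu : pointMeasure R => mu setT)).
by rewrite !pm_of_seqT => -[] /eqP; rewrite oner_eq0.
Qed.

Definition nz_dirac (x : R) : nzPointMeasure R :=
  exist _ (pm_of_seq [:: x]) (pm_dirac_neq0 x).

Definition nz_val (mu : nzPointMeasure R) : pointMeasure R := set_val mu.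

HB.instance Definition _ := Topological.on (nzPointMeasure R).
HB.instance Definition _ := isPointed.Build (nzPointMeasure R) (nz_dirac 0).
HB.instance Definition _ := Measurable.copy (nzPointMeasure R)
  (g_sigma_algebraType (@open (nzPointMeasure R))).

End nzPointMeasure.

Section offspring.
Context (R : realType) (p : probability nat R).

Definition offspring_mean : \bar R :=
  (\sum_(0 <= j <oo) (j%:R%:E * p [set j]))%E.

Definition offspring_gf (s : R) : R :=
  limn (series (fun j => fine (p [set j]) * s ^+ j)).

End offspring.

(* Ulam-Harris labelling: a particle is labelled by the index i of its ancestor
   in generation 0 and a word u; the ancestor i itself has the empty word, and
   the j-th child of (i, u) is (i, rcons u j).  Only the particles that are
   actually born matter: [children] and [position] are arbitrary on the other
   labels. *)
Record particleSystem d (Omega : measurableType d) (R : realType) :=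
  ParticleSystem {
    ancestors : {mfun Omega >-> nat};
    children : nat -> seq nat -> {mfun Omega >-> nat};
    position : nat -> seq nat -> {mfun Omega >-> measurableTypeR R} }.

Section tree.
Context d (Omega : measurableType d) (R : realType).
Variables (c : seq nat -> Omega -> nat) (X : seq nat -> Omega -> R).

Fixpoint generation (n : nat) (w : Omega) : seq (seq nat) :=
  if n is n'.+1
  then [seq rcons u j | u <- generation n' w, j <- iota 0 (c u w)]
  else [:: [::]].

Definition born (u : seq nat) : set Omega :=
  [set w | u \in generation (size u) w].

(* The sigma-algebra of the genealogy and the positions of the particles with
   label in L. *)
Definition genealogy (L : set (seq nat)) : set (set Omega) :=
  <<s [set E | exists u (B : set (measurableTypeR R)),
        [/\ L u, measurable B & E = born u `&` X u @^-1` B] ] >>.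

Definition past (n : nat) : set (set Omega) :=
  genealogy [set u | (size u <= n)%N].

Variables (p : probability nat R)
  (P : R.-pker (measurableTypeR R) ~> (measurableTypeR R)).

(* Under Pr, the tree (c, X) is a branching Markov chain started from one
   particle at x: conditionally on the past up to generation n, the particles u
   of generation n have independent families of children, u having k children
   with probability p_k, placed independently according to P (X u). *)
Definition branching_chain_from (Pr : probability Omega R) (x : R) : Prop :=
  {ae Pr, forall w, X [::] w = x} /\
  forall (n : nat) (U : seq (seq nat)) (A : set Omega) (k : seq nat -> nat)
      (B : seq nat -> nat -> set (measurableTypeR R)),
    uniq U -> (forall u, u \in U -> size u = n) ->
    past n A -> (forall u, u \in U -> A `<=` born u) ->
    (forall u j, measurable (B u j)) ->
    Pr (A `&` \bigcap_(u in [set` U])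
          (c u @^-1` [set k u] `&`
           \bigcap_(j in `I_(k u)) (X (rcons u j) @^-1` B u j))) =
    (\int[Pr]_(w in A)
       \prod_(u <- U) (p [set k u] * \prod_(j < k u) P (X u w) (B u j)))%E.

End tree.

Section chain.
Context d (Omega : measurableType d) (R : realType).
Variable S : particleSystem Omega R.

(* Under Pr, the system is the union of independent branching Markov chains
   started from single particles at the atoms of mu. *)
Definition branching_Markov_chain (p : probability nat R)
    (P : R.-pker (measurableTypeR R) ~> (measurableTypeR R))
    (mu : pointMeasure R) (Pr : probability Omega R) : Prop :=
  exists s : seq R,
  [/\ mu = pm_of_seq s,
      {ae Pr, forall w, ancestors S w = size s},
      forall i, (i < size s)%N ->
        branching_chain_from (children S i) (position S i) p P Pr (nth 0 s i) &
      forall A : nat -> set Omega,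
        (forall i, (i < size s)%N ->
          genealogy (children S i) (position S i) setT (A i)) ->
        Pr (\bigcap_(i in `I_(size s)) A i) =
        (\prod_(i < size s) Pr (A i))%E ].

Definition population (n : nat) (w : Omega) : pointMeasure R :=
  pm_of_seq (flatten
    [seq [seq position S i u w | u <- generation (children S i) n w]
      | i <- iota 0 (ancestors S w)]).

Definition population_size (n : nat) (w : Omega) : \bar R :=
  population n w setT.

Variable Prob : nzPointMeasure R -> probability Omega R.

Definition mixture (Q : probability (nzPointMeasure R) R) (E : set Omega)
  : \bar R := (\int[Q]_mu Prob mu E)%E.

Definition quasi_stationary (Q : probability (nzPointMeasure R) R) : Prop :=
  forall (n : nat) (B : set (nzPointMeasure R)), measurable B ->
    let survival := [set w | (0 < population_size n w)%E] in
    fine (mixture Q ([set w | (@nz_val R @` B) (population n w)] `&` survival)) /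
    fine (mixture Q survival) = fine (Q B).

End chain.

Section pgfl.
Context (R : realType).

Definition V0 (h : R -> R) : Prop :=
  [/\ measurable_fun [set: measurableTypeR R]
        (h : measurableTypeR R -> measurableTypeR R),
      0 < inf (range h) & forall x, h x <= 1].

Definition exp_log (mu : pointMeasure R) (h : R -> R) : R :=
  expR (\int[mu]_x ln (h x)).

Definition pgfl (Q : probability (nzPointMeasure R) R) (h : R -> R) : R :=
  \int[Q]_mu exp_log (nz_val mu) h.

Definition offspring_pgfl d (Omega : measurableType d)
    (S : particleSystem Omega R) (Prob : nzPointMeasure R -> probability Omega R)
    (h : R -> R) (x : R) : R :=
  \int[Prob (nz_dirac x)]_w exp_log (population S 1 w) h.

End pgfl.

(* Main.v *)
(** Write G for the generating functional of one generation.  Conditioning on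
    generation n turns Z_(n+1)(log h) into Z_n(log G[h]), so
    E_mu[exp Z_(n+1)(log h)] = E_mu[exp Z_n(log G[h])], and the extinction
    probability of the first generation is p_0 = f(0) per particle.

    If Q is quasi-stationary and r is its survival probability after one unit of
    time, the law of Z_1 under the mixture is r Q + (1 - r) \delta_0.
    Integrating exp (mu(log h)) gives the equation with r in place of m ^ alpha.
    As p_0 > 0 because m < 1, one has 0 < r < 1, and alpha = ln r / ln m.

    Conversely, put r = m ^ alpha; h = 1 gives G_Q[f(0)] = 1 - r.  By induction
    on n, the law of Z_n under the mixture and r^n Q + (1 - r^n) \delta_0 have
    the same generating functional.  Such functionals determine laws, first on
    the sigma-algebra of the counts mu(A), then on the Borel sets of the weak
    topology: a weakly open set is a countable union of sets given by counts,
    since the ordered atoms of a point measure can be located in rational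
    intervals by its values on half-lines. *)

Require Import Defs.
From HB Require Import structures.
From mathcomp Require Import all_boot all_order all_algebra.
From mathcomp Require Import all_classical all_reals all_analysis.
From mathcomp Require Import measurable_realfun ring.

Import Order.TTheory GRing.Theory Num.Theory.
Import numFieldNormedType.Exports.

Set Implicit Arguments.
Unset Strict Implicit.
Unset Printing Implicit Defensive.

Local Open Scope classical_set_scope.
Local Open Scope ring_scope.

(** * Bounded measurable functions and monotone vector classes *)

(** Every hypothesis speaks of events: [branching_chain_from] of finitely many labels with
    prescribed numbers of children and Borel sets of positions, independence of genealogical events,
    quasi-stationarity of Borel sets. Each passage from events to functions, or back, is a monotone
    class argument, so linear spaces of functions closed under bounded pointwise limits ([mvclass])
    carry the proof. A product over a random generation is reached as a limit of products over
    finite sets of labels.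

    [Prob] is merely a family of probabilities, so the measurability of mu |-> E_mu[F(Z_n)] has to
    be derived. Iterating the branching property down to generation 0 gives E_mu[exp Z_n(log h)] =
    exp mu(log h_n), with h_n the n-th iterate of h under G, and this is measurable in mu; the
    argument by which generating functionals separate laws then extends it to all events given by
    counts.

    Extinction corresponds to h = 0, which has no logarithm. The branching property is therefore
    proved for products over the list of atoms, with h valued in [0, 1]. One step leads back into
    [V0], because G[h] >= p_0 > 0. *)

Section bounded_measurable.
Context d (T : measurableType d) (R : realType).

Definition bmf (f : T -> R) :=
  measurable_fun [set: T] f /\ exists M, forall x, `|f x| <= M.

Lemma bmf_cst (a : R) : bmf (fun=> a).
Proof. by split; [exact: measurable_cst|exists `|a|]. Qed.

Lemma bmfM f g : bmf f -> bmf g -> bmf (fun x => f x * g x).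
Proof.
move=> [mf [M fM]] [mg [N gN]]; split; first exact: measurable_funM.
by exists (M * N) => x; rewrite normrM ler_pM.
Qed.

Lemma bmfD f g : bmf f -> bmf g -> bmf (fun x => f x + g x).
Proof.
move=> [mf [M fM]] [mg [N gN]]; split; first exact: measurable_funD.
by exists (M + N) => x; rewrite (le_trans (ler_normD _ _)) ?lerD.
Qed.

Lemma bmf_lin a f g : bmf f -> bmf g -> bmf (fun x => a * f x + g x).
Proof. by move=> bf bg; apply: bmfD => //; apply: bmfM => //; exact: bmf_cst. Qed.

Lemma bmf_indic (A : set T) : measurable A -> bmf (\1_A : T -> R).
Proof.
move=> mA; split; first exact: measurable_indic.
by exists 1 => x; rewrite indicE; case: (_ \in _); rewrite ?normr1 ?normr0.
Qed.

Lemma bmf_prod (I : eqType) (s : seq I) (f : I -> T -> R) :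
  (forall i, i \in s -> bmf (f i)) -> bmf (fun x => \prod_(i <- s) f i x).
Proof.
elim: s => [|i s ih] bf.
  by under eq_fun do rewrite big_nil; exact: bmf_cst.
under eq_fun do rewrite big_cons; apply: bmfM; first exact/bf/mem_head.
by apply: ih => j js; apply: bf; rewrite inE js orbT.
Qed.

Lemma bmf_sum (I : Type) (s : seq I) (f : I -> T -> R) :
  (forall i, bmf (f i)) -> bmf (fun x => \sum_(i <- s) f i x).
Proof.
move=> bf; elim: s => [|i s ih].
  by under eq_fun do rewrite big_nil; exact: bmf_cst.
by under eq_fun do rewrite big_cons; exact: bmfD.
Qed.

Lemma bmf_exp f n : bmf f -> bmf (fun x => f x ^+ n).
Proof.
move=> bf; elim: n => [|n ih].
  by under eq_fun do rewrite expr0; exact: bmf_cst.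
by under eq_fun do rewrite exprS; exact: bmfM.
Qed.

Lemma bmf_lim (f_ : nat -> T -> R) f M :
  (forall n, bmf (f_ n)) -> (forall n x, `|f_ n x| <= M) ->
  (forall x, f_ ^~ x @ \oo --> f x) -> bmf f.
Proof.
move=> bf fM cf; split.
  by apply: (measurable_fun_cvg (fun n => (bf n).1)) => x _; exact: cf.
exists M => x; have /cvg_lim <- // : (fun n => `|f_ n x|) @ \oo --> `|f x|.
  by apply: cvg_norm; exact: cf.
apply: limr_le; last exact: nearW.
by apply/cvg_ex; exists `|f x|; apply: cvg_norm; exact: cf.
Qed.

Lemma bmf_01 (f : T -> R) :
  measurable_fun [set: T] f -> (forall x, 0 <= f x <= 1) -> bmf f.
Proof.
by move=> mf f01; split=> //; exists 1 => x; have /andP[? ?] := f01 x;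
  rewrite ger0_norm.
Qed.

End bounded_measurable.

Lemma bmf_comp d d' (T : measurableType d) (U : measurableType d') (R : realType)
    (f : U -> R) (g : T -> U) :
  bmf f -> measurable_fun [set: T] g -> bmf (fun x => f (g x)).
Proof.
move=> [mf [M fM]] mg; split; first exact: measurableT_comp.
by exists M => x.
Qed.

Section Rintegral_bounded.
Context d (T : measurableType d) (R : realType).
Variables (mu : {measure set T -> \bar R}) (mufin : (mu setT < +oo)%E).
Implicit Types f g : T -> R.

Lemma bmf_integrable f : bmf f -> mu.-integrable setT (EFin \o f).
Proof.
move=> [mf [M fM]]; apply: measurable_bounded_integrable => //.
by exists M; split; [exact: num_real|move=> N MN x _; exact/(le_trans (fM x))/ltW].
Qed.

Lemma Rintegral_lin a f g : bmf f -> bmf g ->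
  \int[mu]_x (a * f x + g x) = a * \int[mu]_x f x + \int[mu]_x g x.
Proof.
move=> bf bg; rewrite RintegralD//; last 2 first.
- by apply: bmf_integrable; apply: bmfM => //; exact: bmf_cst.
- exact: bmf_integrable.
by rewrite RintegralZl//; exact: bmf_integrable.
Qed.

Lemma Rintegral_cvg (f_ : nat -> T -> R) f M :
  (forall n, bmf (f_ n)) -> (forall n x, `|f_ n x| <= M) ->
  (forall x, f_ ^~ x @ \oo --> f x) ->
  (fun n => \int[mu]_x f_ n x) @ \oo --> \int[mu]_x f x.
Proof.
move=> bf fM cf.
have bf' := bmf_lim bf fM cf.
have [] := @dominated_convergence _ _ _ mu setT measurableT
  (fun n => EFin \o f_ n) (EFin \o f) (fun=> M%:E).
- by move=> n; apply/measurable_EFinP; exact: (bf n).1.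
- by apply/measurable_EFinP; exact: bf'.1.
- by apply: aeW => x _; apply: cvg_EFin; [exact: nearW|exact: cf].
- exact: (bmf_integrable (bmf_cst _ M)).
- by apply: aeW => x n _ /=; rewrite lee_fin.
move=> _ _ h; apply: fine_cvg; rewrite fineK//.
exact: integrable_fin_num (bmf_integrable bf').
Qed.

Lemma Rintegral_indic (A : set T) : measurable A ->
  \int[mu]_x \1_A x = fine (mu A).
Proof. by move=> mA; rewrite /Rintegral integral_indic// setIT. Qed.

Lemma Rintegral_le f g : bmf f -> bmf g -> (forall x, f x <= g x) ->
  \int[mu]_x f x <= \int[mu]_x g x.
Proof. by move=> bf bg fg; apply: le_Rintegral => //; exact: bmf_integrable. Qed.

End Rintegral_bounded.

Section Rintegral_total_mass1.
Context d (T : measurableType d) (R : realType).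
Variables (mu : {measure set T -> \bar R}) (mu1 : (mu setT = 1)%E).

Lemma total_mass1_fin : (mu setT < +oo)%E.
Proof. by rewrite mu1 ltry. Qed.

Lemma Rintegral_cst1 (a : R) : \int[mu]_x a = a.
Proof. by rewrite Rintegral_cst// mu1 mulr1. Qed.

Lemma Rintegral_bound (f : T -> R) M : bmf f -> (forall x, `|f x| <= M) ->
  `|\int[mu]_x f x| <= M.
Proof.
move=> bf fM; rewrite ler_norml -{1}(Rintegral_cst1 (- M)) -{2}(Rintegral_cst1 M).
by apply/andP; split; apply: (Rintegral_le total_mass1_fin) => //;
  try exact: (bmf_cst T); move=> x; have := fM x; rewrite ler_norml => /andP[].
Qed.

Lemma Rintegral_01 (f : T -> R) : bmf f -> (forall x, 0 <= f x <= 1) ->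
  0 <= \int[mu]_x f x <= 1.
Proof.
move=> bf f01; apply/andP; split.
  by apply: Rintegral_ge0 => x _; case/andP: (f01 x).
apply: le_trans (ler_norm _) _; apply: Rintegral_bound => // x.
by have /andP[f0 f1] := f01 x; rewrite ger0_norm.
Qed.

End Rintegral_total_mass1.

Section monotone_vector_class.
Context (S : Type) (R : realType).

(** Limits are bounded and pointwise rather than monotone: dominated convergence then shows directly
    that an identity between integrals defines such a class. *)
Definition mvclass (H : set (S -> R)) :=
  (forall a f g, H f -> H g -> H (fun x => a * f x + g x)) /\
  (forall (f_ : nat -> S -> R) f M, (forall n, H (f_ n)) ->
     (forall n x, `|f_ n x| <= M) -> (forall x, f_ ^~ x @ \oo --> f x) -> H f).

Definition mvclosure (C : set (S -> R)) : set (S -> R) :=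
  [set f | forall H, mvclass H -> C `<=` H -> H f].

Lemma mvclosure_class C : mvclass (mvclosure C).
Proof.
split=> [a f g Cf Cg H vH CH|f_ f M Cf fM cf H vH CH].
  by apply: vH.1; [exact: Cf|exact: Cg].
by apply: (vH.2 f_ f M) => // n; exact: Cf.
Qed.

Lemma mvclosure_sub C : C `<=` mvclosure C.
Proof. by move=> f Cf H _; exact. Qed.

Variables (H : set (S -> R)) (vH : mvclass H).

(** The empty set satisfies [mvclass], hence the witness [f]. *)
Lemma mvclass0 f : H f -> H (fun=> 0).
Proof.
move=> Hf; rewrite (_ : (fun=> 0) = (fun x => -1 * f x + f x)).
  exact: vH.1.
by apply/funext => x; rewrite mulN1r addNr.
Qed.

Lemma mvclassZ a f : H f -> H (fun x => a * f x).
Proof.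
move=> Hf; rewrite (_ : (fun x => _) = (fun x => a * f x + 0)).
  by apply: vH.1 => //; exact: mvclass0 Hf.
by apply/funext => x; rewrite addr0.
Qed.

Lemma mvclassD f g : H f -> H g -> H (fun x => f x + g x).
Proof.
move=> Hf Hg; rewrite (_ : (fun x => _) = (fun x => 1 * f x + g x)).
  exact: vH.1.
by apply/funext => x; rewrite mul1r.
Qed.

Lemma mvclassB f g : H f -> H g -> H (fun x => f x - g x).
Proof.
move=> Hf Hg; rewrite (_ : (fun x => _) = (fun x => -1 * g x + f x)).
  exact: vH.1.
by apply/funext => x; rewrite mulN1r addrC.
Qed.

Lemma mvclass_sum (I : Type) (s : seq I) (f : I -> S -> R) :
  H (fun=> 0) -> (forall i, H (f i)) -> H (fun x => \sum_(i <- s) f i x).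
Proof.
move=> H0 Hf; elim: s => [|i s ih]; first by under eq_fun do rewrite big_nil.
by under eq_fun do rewrite big_cons; exact: mvclassD.
Qed.

(** Dynkin's theorem: the sets with indicator in [H] form a lambda-system, since proper differences
    are linear combinations and increasing unions are bounded limits. *)
Lemma mvclass_sigma (G : set (set S)) : setI_closed G -> H (fun=> 1) ->
  (forall A, G A -> H \1_A) -> forall A, <<s G >> A -> H \1_A.
Proof.
move=> GI H1 HG; apply: (@lambda_system_subset _ G GI setT [set A | H \1_A]) => //.
split=> // [|A B BA HA HB|F ndF HF] /=.
- by rewrite (_ : \1_setT = fun=> 1)//; apply/funext => x; rewrite indicT.
- rewrite (_ : \1_(A `\` B) = fun x => \1_A x - \1_B x); first exact: mvclassB.
  apply/funext => x; rewrite !indicE in_setD.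
  have := BA x; have [xB|xB] := boolP (x \in B); last first.
    by rewrite andbT subr0.
  by move=> /(_ (set_mem xB))/mem_set ->; rewrite subrr.
- apply: (vH.2 (fun n => \1_(F n)) _ 1) => // [n x|x].
    by rewrite indicE; case: (_ \in _); rewrite ?normr1 ?normr0.
  have [[n _ Fnx]|Fx] := pselect ((\bigcup_i F i) x).
    apply: cvg_near_cst; exists n => // m /= nm; rewrite !indicE !mem_set//.
      by exists n.
    by have /subsetPset := ndF _ _ nm; apply.
  apply: cvg_near_cst; apply: nearW => m; rewrite !indicE !memNset//.
  by apply: contra_not Fx => ?; exists m.
Qed.

End monotone_vector_class.

Section mvclass_bmf.
Context d (T : measurableType d) (R : realType).
Variables (H : set (T -> R)) (vH : mvclass H).
Hypothesis Hind : forall A, measurable A -> H \1_A.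

Import HBNNSimple.

(** Indicators give simple functions by linearity, these give nonnegative bounded functions as
    limits of their approximations, and adding the bound [M] makes any bounded function
    nonnegative. *)
Lemma mvclass_bmf f : bmf f -> H f.
Proof.
have H0 : H (fun=> 0) by exact: mvclass0 (Hind measurableT).
have H1 : H (fun=> 1).
  rewrite (_ : (fun=> 1) = \1_setT); first exact: Hind.
  by apply/funext => x; rewrite indicT.
have Hcst a : H (fun=> a).
  rewrite (_ : (fun=> a) = fun x => a * 1); first exact: mvclassZ.
  by apply/funext => x; rewrite mulr1.
have Hs (g : {nnsfun T >-> R}) : H g.
  rewrite (_ : (g : T -> R) =
    fun x => \sum_(y <- finmap.enum_fset (fset_set (range g)))
      y * \1_(g @^-1` [set y]) x).
    by apply: mvclass_sum => // y; apply: mvclassZ => //; exact: Hind.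
  apply/funext => x; rewrite {1}fimfunE fsbig_finite//=.
have Hp (g : T -> R) M : measurable_fun setT g -> (forall x, 0 <= g x <= M) -> H g.
  move=> mg gM.
  have mg' : measurable_fun setT (EFin \o g) by exact/measurable_EFinP.
  have g0 x : [set: T] x -> (0 <= (EFin \o g) x)%E.
    by move=> _; rewrite lee_fin; case/andP: (gM x).
  apply: (vH.2 (fun n => nnsfun_approx measurableT mg' n) g M) => // [n x|x].
    rewrite ger0_norm//; have /andP[_] := gM x; apply: le_trans.
    by rewrite -lee_fin nnsfun_approxE; exact: le_approx.
  by have /fine_cvg := @cvg_nnsfun_approx _ _ _ _ measurableT _ mg' g0 x Logic.I.
move=> [mf [M fM]].
rewrite (_ : f = fun x => (f x + M) - M); last by apply/funext => x; rewrite addrK.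
apply: (mvclassB vH) => //; apply: (Hp _ (M + M)).
  by apply: measurable_funD => //; exact: measurable_cst.
move=> x; have := fM x; rewrite ler_norml => /andP[? ?].
by rewrite lerD2r -lerBlDr sub0r; apply/andP.
Qed.

End mvclass_bmf.

(** The maps [l] and [r] let one function on [S] carry both sides of an identity, so that both are
    extended together; the weights hold the factors that stay fixed. Boundedness is part of the
    class because integrals are linear and continuous only there. *)
Lemma mvclass_Rintegral_eq d d' (T : measurableType d) (U : measurableType d')
    (R : realType) (S : Type)
    (mu : {measure set T -> \bar R}) (nu : {measure set U -> \bar R})
    (l : T -> S) (r : U -> S) w w' :
  (mu setT < +oo)%E -> (nu setT < +oo)%E -> bmf w -> bmf w' ->
  mvclass [set f : S -> R | [/\ bmf (f \o l), bmf (f \o r) &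
    \int[mu]_x (w x * f (l x)) = \int[nu]_x (w' x * f (r x))]].
Proof.
move=> muf nuf bw bw'; split=> [a f g [bfl bfr fE] [bgl bgr gE]|f_ f M Hf fM cf].
  split; [exact: (bmf_lin a bfl bgl)|exact: (bmf_lin a bfr bgr)|].
  have E v (x : R) y : v * (a * x + y) = a * (v * x) + v * y.
    by rewrite mulrDr mulrCA.
  under eq_Rintegral do rewrite E.
  under [RHS]eq_Rintegral do rewrite E.
  rewrite !Rintegral_lin ?fE ?gE//.
  - exact: (bmfM bw' bfr).
  - exact: (bmfM bw' bgr).
  - exact: (bmfM bw bfl).
  - exact: (bmfM bw bgl).
have bl : bmf (f \o l).
  by apply: (@bmf_lim _ _ _ (fun n => f_ n \o l) _ M) => [n||]; [case: (Hf n)| |];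
    rewrite /=.
have br : bmf (f \o r).
  by apply: (@bmf_lim _ _ _ (fun n => f_ n \o r) _ M) => [n||]; [case: (Hf n)| |];
    rewrite /=.
split=> //.
have cvgw d0 (V : measurableType d0) (la : {measure set V -> \bar R}) q v :
    (la setT < +oo)%E -> bmf v -> (forall n, bmf (f_ n \o q)) ->
    (fun n => \int[la]_x (v x * f_ n (q x))) @ \oo --> \int[la]_x (v x * f (q x)).
  move=> laf bv bq; have [_ [N vN]] := bv.
  apply: (@Rintegral_cvg _ _ _ la laf _ _ (N * M)) => [n|n x|x].
  - exact: (bmfM bv (bq n)).
  - by rewrite normrM ler_pM.
  - by apply: cvgM; [exact: cvg_cst|exact: cf].
have c1 := cvgw _ _ mu l w muf bw (fun n => let: And3 h _ _ := Hf n in h).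
have c2 := cvgw _ _ nu r w' nuf bw' (fun n => let: And3 _ h _ := Hf n in h).
have E : (fun n => \int[mu]_x (w x * f_ n (l x))) =
         (fun n => \int[nu]_x (w' x * f_ n (r x))).
  by apply/funext => n; case: (Hf n).
by rewrite E in c1; exact: (@norm_cvg_unique _ _ _ _ _ _ c1 c2).
Qed.

Lemma measurable_Rintegral_kernel d d' (X : measurableType d)
    (Y : measurableType d') (R : realType) (k : X -> {measure set Y -> \bar R}) :
  (forall x, k x setT < +oo)%E ->
  (forall A, measurable A -> measurable_fun [set: X] (k ^~ A)) ->
  forall f : Y -> R, bmf f -> measurable_fun [set: X] (fun x => \int[k x]_y f y).
Proof.
move=> kfin mk f bf.
suff [] : bmf f /\ measurable_fun [set: X] (fun x => \int[k x]_y f y) by [].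
move: f bf; apply: (@mvclass_bmf _ _ _
  [set f | bmf f /\ measurable_fun [set: X] (fun x => \int[k x]_y f y)]).
  split=> [a f g [bf mf] [bg mg]|f_ f M bf fM cf].
    split; first exact: bmf_lin.
    under eq_fun do rewrite Rintegral_lin//.
    by apply: measurable_funD => //; apply: measurable_funM.
  split; first by apply: (bmf_lim _ fM cf) => n; case: (bf n).
  apply: (measurable_fun_cvg (h := fun n x => \int[k x]_y f_ n y)).
    by move=> n; case: (bf n).
  by move=> x _; apply: (Rintegral_cvg (kfin x) _ fM cf) => n; case: (bf n).
move=> A mA; split; first exact: bmf_indic.
under eq_fun do rewrite Rintegral_indic//.
by apply: measurableT_comp; [exact: fine_measurable|exact: mk].
Qed.

(** * Multilinear extension *)

Section multilinear_extension.
Context d (T : measurableType d) (R : realType).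
Variables (mu : {measure set T -> \bar R}) (mufin : (mu setT < +oo)%E).

(* A pair of functions on [T] is one function on [T + T], so that the two sides
   of an integral identity are extended from generators simultaneously. *)
Definition on_pair (a b : T -> R) (s : T + T) : R :=
  match s with inl x => a x | inr x => b x end.

Lemma mvclosure_bmf (C : set (T + T -> R)) f :
  (forall f, C f -> bmf (f \o inl) /\ bmf (f \o inr)) ->
  mvclosure C f -> bmf (f \o inl) /\ bmf (f \o inr).
Proof.
move=> bC Cf.
have b0 : bmf (fun _ : T => 0 : R) by exact: (bmf_cst T 0).
(* With both weights equal to 0 the identity is void, and only the regularity of the two halves of
   [f] is kept. *)
have [|bfl bfr _] := Cf _ (@mvclass_Rintegral_eq _ _ T T R _ mu mu inl inr _ _
  mufin mufin b0 b0); last by split.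
move=> g Cg; have [bl br] := bC g Cg; split=> //.
by apply: eq_Rintegral => x _; rewrite !mul0r.
Qed.

(** A product is linear and continuous in each factor, so the factors can be extended one at a time.
    For the first one, the others are absorbed into the weights; once it is a generator, it is
    absorbed in turn and the induction hypothesis treats the rest. This is why the induction lets
    [w] and [w'] vary. *)
Lemma mvclosure_prod (I : eqType) (U : seq I) (C : I -> set (T + T -> R)) w w' :
  uniq U -> bmf w -> bmf w' ->
  (forall i f, C i f -> bmf (f \o inl) /\ bmf (f \o inr)) ->
  (forall f, (forall i, i \in U -> C i (f i)) ->
    \int[mu]_x (w x * \prod_(i <- U) f i (inl x)) =
    \int[mu]_x (w' x * \prod_(i <- U) f i (inr x))) ->
  forall f, (forall i, i \in U -> mvclosure (C i) (f i)) ->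
    \int[mu]_x (w x * \prod_(i <- U) f i (inl x)) =
    \int[mu]_x (w' x * \prod_(i <- U) f i (inr x)).
Proof.
move=> + + + bC; elim: U w w' => [|i U ih] w w'.
  by move=> _ _ _ h f _; exact: h.
move=> /= /andP[iU uU] bw bw' h f Cf.
have CU j : j \in U -> mvclosure (C j) (f j).
  by move=> jU; apply: Cf; rewrite inE jU orbT.
have bfU j : j \in U -> bmf (f j \o inl) /\ bmf (f j \o inr).
  by move=> jU; apply: (mvclosure_bmf (bC j)); exact: CU.
have bW : bmf (fun x => w x * \prod_(j <- U) f j (inl x)).
  by apply: bmfM => //; apply: bmf_prod => j jU; case: (bfU j jU).
have bW' : bmf (fun x => w' x * \prod_(j <- U) f j (inr x)).
  by apply: bmfM => //; apply: bmf_prod => j jU; case: (bfU j jU).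
have E (a b c : R) : a * (b * c) = a * c * b by rewrite [b * c]mulrC mulrA.
under eq_Rintegral do rewrite big_cons E.
under [RHS]eq_Rintegral do rewrite big_cons E.
have [|_ _ //] := Cf i (mem_head _ _) _
  (mvclass_Rintegral_eq inl inr mufin mufin bW bW').
move=> g Cg; have [bl br] := bC i g Cg; split=> //.
under eq_Rintegral do rewrite mulrAC.
under [RHS]eq_Rintegral do rewrite mulrAC.
apply: ih => //; [exact: bmfM|exact: bmfM|move=> f0 Cf0].
(* As [i] is not in [U], the generators [g] and [f0] combine into one family indexed by [i :: U], to
   which [h] applies. *)
pose f1 j := if j == i then g else f0 j.
have f1i : f1 i = g by rewrite /f1 eqxx.
have f1U j : j \in U -> f1 j = f0 j.
  by rewrite /f1; case: eqP => // ->; rewrite (negbTE iU).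
under eq_Rintegral do rewrite -mulrA.
under [RHS]eq_Rintegral do rewrite -mulrA.
transitivity (\int[mu]_x (w x * \prod_(j <- i :: U) f1 j (inl x))).
  apply: eq_Rintegral => x _; rewrite big_cons f1i; congr (_ * (_ * _)).
  by apply: eq_big_seq => j jU; rewrite (f1U j jU).
rewrite h; last first.
  move=> j; rewrite inE => /predU1P[->|jU]; first by rewrite f1i.
  by rewrite f1U//; exact: Cf0.
apply: eq_Rintegral => x _; rewrite big_cons f1i; congr (_ * (_ * _)).
by apply: eq_big_seq => j jU; rewrite (f1U j jU).
Qed.

End multilinear_extension.

(** * The generating function of the offspring law on [0, 1] *)

Section offspring_gf.
Context (R : realType) (p : probability nat R).

Lemma sum_offspring K : \sum_(0 <= k < K) fine (p [set k]) = fine (p `I_K).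
Proof.
elim: K => [|K ih]; first by rewrite big_geq// II0 measure0.
rewrite big_nat_recr//= ih IIS measureU//; last first.
  by apply/seteqP; split => // x [/= xK xE]; move: xK; rewrite xE ltnn.
by rewrite fineD// fin_num_measure.
Qed.

Lemma offspring_le1 A : fine (p A) <= 1.
Proof.
by rewrite -lee_fin fineK ?fin_num_measure// probability_le1.
Qed.

Variables (s : R) (s01 : 0 <= s <= 1).

Lemma offspring_gf_term k : 0 <= fine (p [set k]) * s ^+ k <= fine (p [set k]).
Proof.
have /andP[s0 s1] := s01.
have p0 : 0 <= fine (p [set k]) by exact: fine_ge0.
by rewrite mulr_ge0 ?exprn_ge0//= ler_piMr// exprn_ile1.
Qed.

Lemma offspring_gf_partial K :
  0 <= series (fun k => fine (p [set k]) * s ^+ k) K <= 1.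
Proof.
apply/andP; split.
  by apply: sumr_ge0 => k _; have /andP[] := offspring_gf_term k.
apply: (@le_trans _ _ (\sum_(0 <= k < K) fine (p [set k]))).
  by apply: ler_sum => k _; have /andP[] := offspring_gf_term k.
by rewrite sum_offspring offspring_le1.
Qed.

Lemma offspring_gf_cvg :
  series (fun k => fine (p [set k]) * s ^+ k) @ \oo --> offspring_gf p s.
Proof.
apply: nondecreasing_is_cvgn.
  by apply: nondecreasing_series => k _ _; have /andP[] := offspring_gf_term k.
by exists 1 => _ [K _ <-]; have /andP[] := offspring_gf_partial K.
Qed.

Lemma offspring_gf_01 : 0 <= offspring_gf p s <= 1.
Proof.
have c := cvgP _ offspring_gf_cvg.
apply/andP; split.
  by apply: limr_ge => //; apply: nearW => K; have /andP[] := offspring_gf_partial K.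
by apply: limr_le => //; apply: nearW => K; have /andP[] := offspring_gf_partial K.
Qed.

Lemma offspring_gf_ge : fine (p [set 0%N]) <= offspring_gf p s.
Proof.
have c := cvgP _ offspring_gf_cvg.
apply: limr_ge => //; exists 1%N => // K /= K1.
rewrite /series /= big_ltn// expr0 mulr1 lerDl.
by rewrite sumr_ge0// => k _; have /andP[] := offspring_gf_term k.
Qed.

End offspring_gf.

Lemma offspring_gf0 (R : realType) (p : probability nat R) :
  offspring_gf p 0 = fine (p [set 0%N]).
Proof.
apply/cvg_lim => //; apply: cvg_near_cst; exists 1%N => // K /= K1.
rewrite /series /= big_ltn// expr0 mulr1 big_nat_cond big1 ?addr0// => k.
by rewrite andbT => /andP[k0 _]; rewrite expr0n gtn_eqF ?mulr0.
Qed.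

Lemma offspring_gf1 (R : realType) (p : probability nat R) :
  offspring_gf p 1 = 1.
Proof.
apply/cvg_lim => //; rewrite /series /=.
under eq_fun do under eq_bigr do rewrite expr1n mulr1.
under eq_fun do rewrite sum_offspring.
rewrite (_ : 1 = fine (p setT)); last by rewrite probability_setT.
apply: fine_cvg; rewrite fineK ?fin_num_measure//.
have -> : [set: nat] = \bigcup_K `I_K.
  by apply/seteqP; split => // k _; exists k.+1 => //=.
apply: nondecreasing_cvg_mu => //.
by move=> a b ab; apply/subsetPset => k /= /leq_trans; exact.
Qed.

(** * Trees *)

Section labels.

(** A deterministic finite exhaustion of the words of length [n], by their code in the countable
    type of words. Every generation [n] is eventually contained in it as [N] grows. *)
Definition labels (n N : nat) : seq (seq nat) :=
  [seq u <- pmap pickle_inv (iota 0 N) | size u == n].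

Lemma labels_uniq n N : uniq (labels n N).
Proof.
apply: filter_uniq; rewrite (pmap_uniq (@pickle_invK _)) ?iota_uniq//.
Qed.

Lemma mem_labels n N u : size u = n -> (pickle u < N)%N -> u \in labels n N.
Proof.
move=> un uN; rewrite mem_filter un eqxx /= mem_pmap.
by apply/mapP; exists (pickle u); rewrite ?mem_iota// pickleK_inv.
Qed.

Lemma size_labels n N u : u \in labels n N -> size u = n.
Proof. by rewrite mem_filter => /andP[/eqP]. Qed.

Lemma big_labels (R : comSemiRingType) (F : seq nat -> R) n (s : seq (seq nat)) :
  uniq s -> (forall u, u \in s -> size u = n) ->
  \forall N \near \oo,
    \prod_(u <- labels n N) (if u \in s then F u else 1) = \prod_(u <- s) F u.
Proof.
move=> us sn; exists (\max_(u <- s) (pickle u).+1)%N => // N /= sN.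
rewrite -big_mkcond -big_filter; apply: perm_big; apply: uniq_perm => //.
  exact/filter_uniq/labels_uniq.
move=> u; rewrite mem_filter andb_idr// => uS.
apply: mem_labels; first exact: sn.
by apply: leq_trans sN; exact: (leq_bigmax_seq (F := fun v => (pickle v).+1) u uS).
Qed.

End labels.

Section product_over_generation.
Context d (Omega : measurableType d) (R : realType) (c : seq nat -> Omega -> nat).

Lemma generation_size n w u : u \in generation c n w -> size u = n.
Proof.
elim: n u => [|n ih] u /=; first by rewrite inE => /eqP ->.
by move=> /allpairsPdep[v [j [vn _ ->]]]; rewrite size_rcons (ih v).
Qed.

Lemma generation_uniq n w : uniq (generation c n w).
Proof.
elim: n => //= n ih; apply: allpairs_uniq_dep => // [u _|]; first exact: iota_uniq.
by move=> [u i] [v j] _ _ /= /rcons_inj [-> ->].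
Qed.

Lemma cvg_prod_generation (F : seq nat -> R) n w :
  (fun N => \prod_(u <- labels n N) (if u \in generation c n w then F u else 1))
    @ \oo --> \prod_(u <- generation c n w) F u.
Proof.
apply: cvg_near_cst; apply: big_labels; first exact: generation_uniq.
by move=> u; exact: generation_size.
Qed.

(** Measurability is asked only where [u] is born. This allows the sigma-algebra [genealogy], for
    which the positions of unborn labels need not be measurable. *)
Definition born_measurable (F : seq nat -> Omega -> R) :=
  forall u Y, measurable Y -> measurable (born c u `&` F u @^-1` Y).

Lemma measurable_if_born F n u : born_measurable F -> size u = n ->
  measurable_fun setT (fun w => if u \in generation c n w then F u w else 1).
Proof.
move=> mF un _ Y mY; rewrite setTI.
have mb : measurable (born c u) by rewrite -[born c u]setIT; exact: (mF u setT).
rewrite [X in measurable X](_ : _ = (born c u `&` F u @^-1` Y) `|`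
    (~` born c u `&` (if 1 \in Y then setT else set0))).
  apply: measurableU; first exact: mF.
  by apply: measurableI; [exact: measurableC|case: ifP].
rewrite /born un; apply/seteqP; split => w /=;
  have [uw|/negP uw] := boolP (u \in generation c n w).
- by left.
- by right; split=> //; rewrite mem_set.
- by move=> [[]//|[]].
- by move=> [[]//|[_]]; case: ifPn => [|_ []]; rewrite ?inE.
Qed.

Lemma measurable_prod_generation F n : born_measurable F ->
  measurable_fun setT (fun w => \prod_(u <- generation c n w) F u w).
Proof.
move=> mF; apply: (measurable_fun_cvg (h := fun N w => \prod_(u <- labels n N)
   (if u \in generation c n w then F u w else 1))); last first.
  by move=> w _; exact: cvg_prod_generation.
(* [measurable_prod] asks for the measurability of every factor, hence the guard [size u == n],
   which holds on [labels n N]. *)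
move=> N; rewrite (_ : (fun w => _) = fun w => \prod_(u <- labels n N)
    (if (size u == n) && (u \in generation c n w) then F u w else 1)).
  apply: measurable_prod => u _.
  have [un|un] := eqVneq (size u) n => /=; last exact: measurable_cst.
  exact: measurable_if_born.
apply/funext => w; apply: eq_big_seq => u /size_labels ->; by rewrite eqxx.
Qed.

End product_over_generation.

Section tree.
Context d (Omega : measurableType d) (R : realType).
Variables (c : seq nat -> Omega -> nat) (X : seq nat -> Omega -> R).
Hypothesis mc : forall u, measurable_fun [set: Omega] (c u).
Hypothesis mX : forall u,
  measurable_fun [set: Omega] (X u : Omega -> measurableTypeR R).

Lemma mem_generationS n w u j :
  (rcons u j \in generation c n.+1 w) = (u \in generation c n w) && (j < c u w)%N.
Proof.
apply/allpairsPdep/andP => [[v [i [vn + /rcons_inj[-> ->]]]]|[un ju]].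
  by rewrite mem_iota.
by exists u, j; rewrite mem_iota.
Qed.

Lemma measurable_mem_generation n u :
  measurable [set w | u \in generation c n w].
Proof.
elim: n u => [|n ih] u /=.
  have [uE|uE] := boolP (u \in [:: [::]]).
    by rewrite [X in measurable X](_ : _ = setT)//; apply/seteqP.
  by rewrite [X in measurable X](_ : _ = set0)//; apply/seteqP; split.
case/lastP: u => [|u j].
  rewrite [X in measurable X](_ : _ = set0)//; apply/seteqP; split => // w /=.
  by move=> wE; have := @generation_size _ _ c n.+1 w [::] wE.
rewrite [X in measurable X](_ : _ = [set w | u \in generation c n w] `&`
    (c u @^-1` [set k | (j < k)%N])).
  by apply: measurableI => //; rewrite -[X in measurable X]setTI; exact: mc.
by apply/seteqP; split => w /=; rewrite -/(generation c n.+1 w) mem_generationS;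
  move=> /andP.
Qed.

Lemma measurable_born u : measurable (born c u).
Proof. exact: measurable_mem_generation. Qed.

Lemma genealogy_measurable L A : genealogy c X L A -> measurable A.
Proof.
apply: smallest_sub; first exact: sigma_algebra_measurable.
move=> _ [u [B [_ mB ->]]]; apply: measurableI; first exact: measurable_born.
by rewrite -[X in measurable X]setTI; exact: mX.
Qed.

Lemma genealogy_algebra L : sigma_algebra setT (genealogy c X L).
Proof. exact: smallest_sigma_algebra. Qed.

Lemma genealogyC L A : genealogy c X L A -> genealogy c X L (~` A).
Proof. by move=> gA; rewrite -setTD; have [_ h _] := genealogy_algebra L; exact: h. Qed.

Lemma genealogyI L A B : genealogy c X L A -> genealogy c X L B ->
  genealogy c X L (A `&` B).
Proof.
move=> gA gB; have := @smallest_sigma_algebra _ setT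
  [set E | exists u (B : set (measurableTypeR R)),
        [/\ L u, measurable B & E = born c u `&` X u @^-1` B] ].
move=> /sigma_algebraP[]; first by [].
by move=> _ _ _; apply.
Qed.

Lemma genealogy_born (L : set (seq nat)) u : L u -> genealogy c X L (born c u).
Proof.
move=> Lu; apply: sub_gen_smallest; exists u, setT; split=> //.
by rewrite preimage_setT setIT.
Qed.

End tree.

Lemma indic_bigcap_seq (R : pzRingType) (T : Type) (I : choiceType) (s : seq I)
    (F : I -> set T) x :
  \1_(\bigcap_(i in [set` s]) F i) x = \prod_(i <- s) \1_(F i) x :> R.
Proof.
rewrite bigcap_seq; elim: s => [|i s ih]; first by rewrite !big_nil indicT.
by rewrite !big_cons -ih indicE in_setI -mulnb natrM !indicE.
Qed.

Lemma indic_bigcap_ord (R : pzRingType) (T : Type) k (F : nat -> set T) x :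
  \1_(\bigcap_(i in `I_k) F i) x = \prod_(i < k) \1_(F i) x :> R.
Proof.
rewrite -(big_mkord predT (fun i => \1_(F i) x)) /index_iota subn0.
rewrite -indic_bigcap_seq; congr (\1_(\bigcap_(i in _) F i) x).
by apply/seteqP; split => i /=; rewrite mem_iota.
Qed.

(** The nested product becomes a single one over pairs (parent, rank of the child), the flat shape
    to which [mvclosure_prod] applies. *)
Lemma prod_leaves (R : comPzRingType) (U : seq (seq nat)) (k : seq nat -> nat)
    (a : seq nat -> R) (b : seq nat * nat -> R) :
  \prod_(u <- U) (a u * \prod_(j < k u) b (u, j : nat)) =
  (\prod_(u <- U) a u) *
  \prod_(v <- [seq (u, j) | u <- U, j <- iota 0 (k u)]) b v.
Proof.
rewrite big_split /= big_allpairs_dep; congr (_ * _); apply: eq_bigr => u _.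
by rewrite -(big_mkord predT (fun j => b (u, j))) /index_iota subn0.
Qed.

(** * The branching property for one tree: from generation n + 1 to generation n *)

Section branching_property.
Context d (Omega : measurableType d) (R : realType).
Variables (c : seq nat -> Omega -> nat) (X : seq nat -> Omega -> R).
Hypothesis mc : forall u, measurable_fun [set: Omega] (c u).
Hypothesis mX : forall u,
  measurable_fun [set: Omega] (X u : Omega -> measurableTypeR R).
Variables (p : probability nat R)
  (P : R.-pker (measurableTypeR R) ~> (measurableTypeR R)).
Variables (Pr : probability Omega R) (x : R).
Hypothesis hbr : branching_chain_from c X p P Pr x.
Variable h : measurableTypeR R -> R.
Hypotheses (mh : measurable_fun [set: measurableTypeR R] h)
  (h01 : forall y, 0 <= h y <= 1).

Let Prfin : (Pr setT < +oo)%E.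
Proof. exact/total_mass1_fin/probability_setT. Qed.

Lemma pker_fin y : (P y setT < +oo)%E.
Proof. exact/total_mass1_fin/prob_kernel. Qed.

Lemma pker_fin_num y A : measurable A -> P y A \is a fin_num.
Proof.
move=> mA; rewrite ge0_fin_numE//; apply: le_lt_trans (pker_fin y).
by apply: le_measure; rewrite ?inE.
Qed.

Lemma bmf_pker f : bmf f -> bmf (fun y => \int[P y]_z f z).
Proof.
move=> bf; split.
  by apply: (measurable_Rintegral_kernel pker_fin) => // A mA; exact: measurable_kernel.
by have [_ [M fM]] := bf; exists M => y; exact: (Rintegral_bound (prob_kernel y)).
Qed.

(** The defining identity of the chain, turned into real integrals of products of indicators: the
    base case of the extensions below. *)
Lemma branching_Rintegral n U A (k : seq nat -> nat)
    (B : seq nat -> nat -> set (measurableTypeR R)) :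
  uniq U -> (forall u, u \in U -> size u = n) -> past c X n A ->
  (forall u, u \in U -> A `<=` born c u) -> (forall u j, measurable (B u j)) ->
  \int[Pr]_w (\1_A w * \prod_(u <- U) (\1_(c u @^-1` [set k u]) w *
     \prod_(j < k u) \1_(X (rcons u j) @^-1` B u j) w)) =
  \int[Pr]_w (\1_A w * \prod_(u <- U) (fine (p [set k u]) *
     \prod_(j < k u) fine (P (X u w) (B u j)))).
Proof.
move=> uU Un pA AU mB; have [_ hb] := hbr.
have := hb n U A k B uU Un pA AU mB => /(congr1 fine).
set E := (A `&` _).
have mcap u : measurable (c u @^-1` [set k u] `&`
    \bigcap_(j in `I_(k u)) (X (rcons u j) @^-1` B u j)).
  apply: measurableI; first by rewrite -[X in measurable X]setTI; exact: mc.
  apply: bigcap_measurableType => j _.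
  by rewrite -[X in measurable X]setTI; exact: mX.
have mE : measurable E.
  apply: measurableI; first exact: genealogy_measurable pA.
  by rewrite bigcap_seq; apply: bigsetI_measurable => u _; exact: mcap.
rewrite -Rintegral_indic// => EE; transitivity (\int[Pr]_w \1_E w).
  apply: eq_Rintegral => w _; rewrite [RHS]indicE in_setI -mulnb natrM -!indicE.
  rewrite indic_bigcap_seq; congr (_ * _); apply: eq_bigr => u _.
  by rewrite [RHS]indicE in_setI -mulnb natrM -!indicE indic_bigcap_ord.
rewrite {}EE.
transitivity (\int[Pr]_(w in A) (\prod_(u <- U) (fine (p [set k u]) *
     \prod_(j < k u) fine (P (X u w) (B u j))))).
  congr fine; apply: eq_integral => w _; rewrite -prodEFin.
  apply: eq_bigr => u _; rewrite EFinM -prodEFin fineK ?fin_num_measure//.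
  by congr (_ * _)%E; apply: eq_bigr => j _; rewrite fineK// pker_fin_num.
rewrite Rintegral_mkcond; apply: eq_Rintegral => w _.
by rewrite patchE indicE; case: (w \in A); rewrite ?mul1r ?mul0r.
Qed.

(** The closed form of G[h]: the children of a particle at [y] are independent with law [P y], so k
    of them contribute the k-th power of the mean of [h]. The link with [offspring_pgfl] is
    [offspring_pgflE]. *)
Definition offspring_map (y : R) := offspring_gf p (\int[P y]_z h z).

Definition brood (u : seq nat) (w : Omega) := \prod_(j < c u w) h (X (rcons u j) w).

Let bh : bmf h. Proof. exact: bmf_01. Qed.

Lemma pker_01 y : 0 <= \int[P y]_z h z <= 1.
Proof. exact: (Rintegral_01 (prob_kernel y)). Qed.

Lemma offspring_map_01 y : 0 <= offspring_map y <= 1.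
Proof. exact/offspring_gf_01/pker_01. Qed.

Lemma measurable_offspring_map : measurable_fun [set: measurableTypeR R] offspring_map.
Proof.
apply: (measurable_fun_cvg (h := fun K y =>
  series (fun k => fine (p [set k]) * (\int[P y]_z h z) ^+ k) K)).
  move=> K; apply: measurable_sum => k; apply: measurable_funM => //.
  by apply: measurable_funX; case: (bmf_pker bh).
by move=> y _; exact/offspring_gf_cvg/pker_01.
Qed.

Lemma brood_01 u w : 0 <= brood u w <= 1.
Proof.
apply/andP; split; first by apply: prodr_ge0 => j _; case/andP: (h01 (X (rcons u j) w)).
by apply: prodr_ile1 => j _.
Qed.

Let bX (f : measurableTypeR R -> R) u : bmf f -> bmf (fun w => f (X u w)).
Proof. by move=> bf; exact: (bmf_comp bf (mX u)). Qed.

Let bc u k : bmf (\1_(c u @^-1` [set k]) : Omega -> R).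
Proof. by apply: bmf_indic; rewrite -[X in measurable X]setTI; exact: mc. Qed.

Let bA n A : past c X n A -> bmf (\1_A : Omega -> R).
Proof. by move=> pA; exact/bmf_indic/(genealogy_measurable mc mX pA). Qed.

(** For prescribed numbers of children both sides are multilinear in the functions read at the
    children. The generators pair the indicator of [B] at a child with [P (X u) B] at its parent;
    their closure contains [h] at the child paired with its mean at the parent. *)
Lemma branching_fixed_numbers n U A (k : seq nat -> nat) :
  uniq U -> (forall u, u \in U -> size u = n) -> past c X n A ->
  (forall u, u \in U -> A `<=` born c u) ->
  \int[Pr]_w (\1_A w * \prod_(u <- U) (\1_(c u @^-1` [set k u]) w *
     \prod_(j < k u) h (X (rcons u j) w))) =
  \int[Pr]_w (\1_A w * \prod_(u <- U) (fine (p [set k u]) *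
     (\int[P (X u w)]_z h z) ^+ k u)).
Proof.
move=> uU Un pA AU; have b1A := bA pA.
have L1 (b : seq nat * nat -> Omega -> R) w : \1_A w *
    \prod_(u <- U) (\1_(c u @^-1` [set k u]) w * \prod_(j < k u) b (u, j : nat) w) =
    (\1_A w * \prod_(u <- U) \1_(c u @^-1` [set k u]) w) *
    \prod_(v <- [seq (u, j) | u <- U, j <- iota 0 (k u)]) b v w.
  by rewrite (prod_leaves _ _ _ (b ^~ w)) mulrA.
have L2 (b : seq nat * nat -> Omega -> R) w : \1_A w *
    \prod_(u <- U) (fine (p [set k u]) * \prod_(j < k u) b (u, j : nat) w) =
    (\1_A w * \prod_(u <- U) fine (p [set k u])) *
    \prod_(v <- [seq (u, j) | u <- U, j <- iota 0 (k u)]) b v w.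
  by rewrite (prod_leaves _ _ _ (b ^~ w)) mulrA.
under [RHS]eq_Rintegral do under eq_bigr do rewrite -[X in _ ^+ X]card_ord -prodr_const.
under eq_Rintegral do rewrite (L1 (fun v w => h (X (rcons v.1 v.2) w))).
under [RHS]eq_Rintegral do rewrite (L2 (fun v w => \int[P (X v.1 w)]_z h z)).
pose C (v : seq nat * nat) : set (Omega + Omega -> R) :=
  [set f | exists2 B : set (measurableTypeR R), measurable B &
    f = on_pair (fun w => \1_(X (rcons v.1 v.2) @^-1` B) w)
                (fun w => fine (P (X v.1 w) B))].
have bP (f : measurableTypeR R -> R) v : bmf f ->
    bmf (fun w => \int[P (X v w)]_z f z).
  by move=> bf; exact: (bX v (bmf_pker bf)).
apply: (@mvclosure_prod _ _ _ Pr Prfin _ _ C _ _ _ _ _ _ _ (fun v =>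
  on_pair (fun w => h (X (rcons v.1 v.2) w)) (fun w => \int[P (X v.1 w)]_z h z))).
- by apply: allpairs_uniq_dep => // [u _|[? ?] [? ?] _ _ [-> ->]//]; exact: iota_uniq.
- by apply: bmfM => //; apply: bmf_prod.
- by apply: bmfM => //; exact: bmf_cst.
- move=> v _ [B mB ->]; split.
    by apply: bmf_indic; rewrite -[X in measurable X]setTI; exact: mX.
  rewrite /comp /=; under eq_fun do rewrite -Rintegral_indic//.
  exact/bP/bmf_indic.
- move=> f Cf.
  have /choice[B HB] v : exists B : set (measurableTypeR R), measurable B /\
      (v \in [seq (u, j) | u <- U, j <- iota 0 (k u)] ->
      f v = on_pair (fun w => \1_(X (rcons v.1 v.2) @^-1` B) w)
                (fun w => fine (P (X v.1 w) B))).
    have [/Cf[B mB fE]|_] := boolP (v \in [seq (u, j) | u <- U, j <- iota 0 (k u)]).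
      by exists B.
    by exists set0.
  transitivity (\int[Pr]_w (\1_A w * \prod_(u <- U) (\1_(c u @^-1` [set k u]) w *
     \prod_(j < k u) \1_(X (rcons u j) @^-1` B (u, j : nat)) w))).
    apply: eq_Rintegral => w _.
    rewrite (L1 (fun v w => \1_(X (rcons v.1 v.2) @^-1` B v) w)); congr (_ * _).
    by apply: eq_big_seq => v /(HB v).2 ->.
  rewrite (@branching_Rintegral n U A k (fun u j => B (u, j)))//; last first.
    by move=> u j; case: (HB (u, j)).
  apply: eq_Rintegral => w _.
  rewrite (L2 (fun v w => fine (P (X v.1 w) (B v)))); congr (_ * _).
  by apply: eq_big_seq => v /(HB v).2 ->.
move=> v _.
suff [] : bmf h /\ mvclosure (C v) (on_pair (fun w => h (X (rcons v.1 v.2) w))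
    (fun w => \int[P (X v.1 w)]_z h z)) by [].
have vC := mvclosure_class (C v).
move: bh; apply: (@mvclass_bmf _ _ _ [set f | bmf f /\ mvclosure (C v)
    (on_pair (fun w => f (X (rcons v.1 v.2) w))
    (fun w => \int[P (X v.1 w)]_z f z))]).
  split=> [a f g [bf Cf] [bg Cg]|f_ f M bf fM cf].
    split; first exact: bmf_lin.
    have := vC.1 a _ _ Cf Cg; congr (mvclosure _ _); apply/funext => -[w|w] //=.
    by rewrite (Rintegral_lin (pker_fin _)).
  have b n0 : bmf (f_ n0) by case: (bf n0).
  split; first exact: bmf_lim b fM cf.
  apply: (vC.2 _ _ M (fun n => (bf n).2)) => [n0 [w|w]|[w|w]] //=.
  - exact: (Rintegral_bound (prob_kernel (s := P) (X v.1 w)) (b n0) (fM n0)).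
  - exact: (Rintegral_cvg (pker_fin _) b fM cf).
move=> B mB; split; first exact: bmf_indic.
apply: mvclosure_sub; exists B => //; apply/funext => -[w|w] //=.
by rewrite Rintegral_indic.
Qed.

Let T k u w := \1_(c u @^-1` [set k]) w * \prod_(j < k) h (X (rcons u j) w).

Let bT k u : bmf (T k u).
Proof. by apply: bmfM => //; apply: bmf_prod => j _; exact: bX. Qed.

Let TK K u w :
  \sum_(0 <= k < K) T k u w = if (c u w < K)%N then brood u w else 0.
Proof.
rewrite /T; under eq_bigr do rewrite indicE.
case: ltnP => cK.
  rewrite (bigD1_seq (c u w)) ?iota_uniq ?mem_index_iota//= mem_set// mul1r.
  rewrite [X in _ + X]big1 ?addr0// => k /eqP kc; rewrite memNset ?mul0r//=.
  by move=> /esym.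
rewrite big_nat_cond big1// => k /andP[/andP[_ kK] _]; rewrite memNset ?mul0r//=.
by move=> cE; move: kK; rewrite -cE ltnNge cK.
Qed.

Let TK_le1 K u w : `|\sum_(0 <= k < K) T k u w| <= 1.
Proof.
rewrite TK; case: ifP => _; last by rewrite normr0.
by have /andP[? ?] := brood_01 u w; rewrite ger0_norm.
Qed.

Let TK_cvg u w : (fun K => \sum_(0 <= k < K) T k u w) @ \oo --> brood u w.
Proof. by apply: cvg_near_cst; exists (c u w).+1 => // K /= cK; rewrite TK cK. Qed.

Lemma bmf_brood u : bmf (brood u).
Proof.
by apply: (@bmf_lim _ _ _ (fun K w => \sum_(0 <= k < K) T k u w) _ 1) => // K;
  exact: bmf_sum.
Qed.

(** Sum over the number k of children of each [u], again one factor at a time: the partial sums of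
    [T k u] tend to [brood u], those of [T' k u] to the generating function, and all are bounded by
    1. *)
Lemma branching_brood n U A :
  uniq U -> (forall u, u \in U -> size u = n) -> past c X n A ->
  (forall u, u \in U -> A `<=` born c u) ->
  \int[Pr]_w (\1_A w * \prod_(u <- U) brood u w) =
  \int[Pr]_w (\1_A w * \prod_(u <- U) offspring_map (X u w)).
Proof.
move=> uU Un pA AU; have b1A := bA pA.
pose T' k u w := fine (p [set k]) * (\int[P (X u w)]_z h z) ^+ k.
have bT' k u : bmf (T' k u).
  by apply: bmfM; [exact: bmf_cst|apply: bmf_exp; exact: (bX u (bmf_pker bh))].
pose C u : set (Omega + Omega -> R) :=
  [set f | exists k, f = on_pair (T k u) (T' k u)].
apply: (@mvclosure_prod _ _ _ Pr Prfin _ _ C _ _ uU b1A b1A _ _ (fun u =>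
  on_pair (brood u) (fun w => offspring_map (X u w)))).
- by move=> u _ [k ->]; split; rewrite /comp /=; [exact: bT|exact: bT'].
- move=> f Cf.
  have /choice[k Hk] u : exists k, u \in U -> f u = on_pair (T k u) (T' k u).
    by have [/Cf[k fE]|_] := boolP (u \in U); [exists k|exists 0%N].
  transitivity (\int[Pr]_w (\1_A w * \prod_(u <- U) T (k u) u w)).
    apply: eq_Rintegral => w _; congr (_ * _).
    by apply: eq_big_seq => u /(Hk u) ->.
  rewrite (branching_fixed_numbers k uU Un pA AU).
  apply: eq_Rintegral => w _; congr (_ * _).
  by apply: eq_big_seq => u /(Hk u) ->.
move=> u _; have vC := mvclosure_class (C u).
have Ck k : mvclosure (C u) (on_pair (T k u) (T' k u)).
  by apply: mvclosure_sub; exists k.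
apply: (vC.2 (fun K s => \sum_(0 <= k < K) on_pair (T k u) (T' k u) s) _ 1).
- by move=> K; apply: (mvclass_sum vC) => //; exact: (mvclass0 vC (Ck 0%N)).
- move=> K [w|w] /=; first exact: TK_le1.
  by have /andP[? ?] := offspring_gf_partial p (pker_01 (X u w)) K; rewrite ger0_norm.
- by move=> [w|w] /=; [exact: TK_cvg|exact/offspring_gf_cvg/pker_01].
Qed.

Lemma bmf_offspring_map : bmf offspring_map.
Proof. exact: (bmf_01 measurable_offspring_map offspring_map_01). Qed.

(* Splitting on whether each label of [V] is born moves it to [U] or discards it. *)
Lemma branching_born n V U A :
  uniq (U ++ V) -> (forall u, u \in U ++ V -> size u = n) -> past c X n A ->
  (forall u, u \in U -> A `<=` born c u) ->
  \int[Pr]_w (\1_A w * \prod_(u <- U) brood u w *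
    \prod_(u <- V) (if u \in generation c n w then brood u w else 1)) =
  \int[Pr]_w (\1_A w * \prod_(u <- U) offspring_map (X u w) *
    \prod_(u <- V) (if u \in generation c n w then offspring_map (X u w) else 1)).
Proof.
elim: V U A => [|v V ih] U A.
  rewrite cats0 => uU Un pA AU.
  under eq_Rintegral do rewrite big_nil mulr1.
  under [RHS]eq_Rintegral do rewrite big_nil mulr1.
  exact: branching_brood uU Un pA AU.
move=> uUV UVn pA AU.
have vn : size v = n by apply: UVn; rewrite mem_cat mem_head orbT.
have pv : past c X n (born c v) by apply: genealogy_born; rewrite /= vn.
have pAv : past c X n (A `&` born c v) by exact: genealogyI.
have pAv' : past c X n (A `&` ~` born c v) by apply: genealogyI => //; exact: genealogyC.
have bF (f : seq nat -> Omega -> R) : (forall u, bmf (f u)) ->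
    forall (A : set Omega) U, past c X n A ->
    bmf (fun w => \1_A w * \prod_(u <- U) f u w *
    \prod_(u <- V) (if u \in generation c n w then f u w else 1)).
  move=> bf A0 U0 pA0; apply: bmfM.
    by apply: bmfM; [exact: (bA pA0)|exact: bmf_prod].
  apply: bmf_prod => u _; rewrite (_ : (fun w => _) = (fun w =>
    \1_[set w | u \in generation c n w] w * f u w +
    \1_(~` [set w | u \in generation c n w]) w)); last first.
    apply/funext => w; rewrite !indicE in_setC; case: ifPn => uw.
      by rewrite mem_set//= mul1r addr0.
    by rewrite memNset//= ?mul0r ?add0r//; exact/negP.
  have mu : measurable [set w | u \in generation c n w].
    exact: measurable_mem_generation.
  apply: bmfD; last exact/bmf_indic/measurableC.
  by apply: bmfM => //; exact: bmf_indic.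
have split (f : seq nat -> Omega -> R) w : \1_A w * \prod_(u <- U) f u w *
    \prod_(u <- v :: V) (if u \in generation c n w then f u w else 1) =
    \1_(A `&` born c v) w * \prod_(u <- v :: U) f u w *
    \prod_(u <- V) (if u \in generation c n w then f u w else 1) +
    \1_(A `&` ~` born c v) w * \prod_(u <- U) f u w *
    \prod_(u <- V) (if u \in generation c n w then f u w else 1).
  rewrite !big_cons !indicE !in_setI in_setC /born vn.
  have -> : (w \in [set w | v \in generation c n w]) = (v \in generation c n w).
    by apply/idP/idP; rewrite inE.
  by case: ifPn => _ /=; rewrite ?andbT ?andbF /=; ring.
under eq_Rintegral do rewrite split.
under [RHS]eq_Rintegral do rewrite (split (fun u w => offspring_map (X u w))).
have bo u : bmf (fun w => offspring_map (X u w)) by exact: (bX u bmf_offspring_map).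
rewrite RintegralD//; last 2 first.
- exact: (bmf_integrable Prfin (bF _ bmf_brood _ _ pAv)).
- exact: (bmf_integrable Prfin (bF _ bmf_brood _ _ pAv')).
rewrite RintegralD//; last 2 first.
- exact: (bmf_integrable Prfin (bF _ bo _ (v :: U) pAv)).
- exact: (bmf_integrable Prfin (bF _ bo _ _ pAv')).
have perm : perm_eq (U ++ v :: V) ((v :: U) ++ V).
  by rewrite -cat_rcons perm_cat2r perm_rcons.
congr (_ + _); apply: ih.
- by rewrite -(perm_uniq perm).
- by move=> u; rewrite -(perm_mem perm); exact: UVn.
- exact: pAv.
- by move=> u; rewrite inE => /predU1P[->|uU]; [exact: subIsetr|
    apply: subset_trans (AU u uU); exact: subIsetl].
- by move: uUV; rewrite (perm_uniq perm) => /= /andP[].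
- by move=> u uUV'; apply: UVn; rewrite (perm_mem perm) /= inE uUV' orbT.
- exact: pAv'.
- by move=> u uU; apply: subset_trans (AU u uU); exact: subIsetl.
Qed.

(** For a finite set of labels, [branching_born] with no label known to be born and [A] the whole
    space gives the identity; the products lie in [0, 1], so letting [N] grow reaches the whole
    generation. *)
Lemma expectation_prod_generationS n :
  \int[Pr]_w (\prod_(v <- generation c n.+1 w) h (X v w)) =
  \int[Pr]_w (\prod_(u <- generation c n w) offspring_map (X u w)).
Proof.
have lim01 (f : seq nat -> Omega -> R) :
    (forall u, bmf (f u)) -> (forall u w, 0 <= f u w <= 1) ->
    (fun N => \int[Pr]_w \prod_(u <- labels n N)
      (if u \in generation c n w then f u w else 1)) @ \oo -->
    \int[Pr]_w \prod_(u <- generation c n w) f u w.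
  move=> bf f01.
  have f01' u w : 0 <= (if u \in generation c n w then f u w else 1) <= 1.
    by case: ifP; rewrite ?ler01 ?lexx.
  apply: (@Rintegral_cvg _ _ _ Pr Prfin _ _ 1) => [N|N w|w].
  - apply: bmf_prod => u /size_labels un; apply: bmf_01 => //.
    apply: measurable_if_born un => v Y mY; apply: measurableI.
      exact: measurable_born.
    by rewrite -[X in measurable X]setTI; exact: (bf v).1.
  - rewrite ger0_norm; first by apply: prodr_ile1.
    by apply: prodr_ge0 => u _; case/andP: (f01' u w).
  - exact: cvg_prod_generation.
have cl := lim01 _ bmf_brood brood_01.
have cr := lim01 (fun u w => offspring_map (X u w))
  (fun u => bX u bmf_offspring_map) (fun u w => offspring_map_01 (X u w)).
transitivity (\int[Pr]_w (\prod_(u <- generation c n w) brood u w)).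
  apply: eq_Rintegral => w _ /=; rewrite big_allpairs_dep; apply: eq_bigr => u _.
  by rewrite /brood -(big_mkord predT (fun j => h (X (rcons u j) w))) /index_iota subn0.
have E : (fun N => \int[Pr]_w \prod_(u <- labels n N)
      (if u \in generation c n w then brood u w else 1)) =
    (fun N => \int[Pr]_w \prod_(u <- labels n N)
      (if u \in generation c n w then offspring_map (X u w) else 1)).
  apply/funext => N.
  have pT : past c X n setT.
    rewrite -setC0; apply: genealogyC.
    by case: (genealogy_algebra c X [set u | (size u <= n)%N]).
  have one (f g : seq nat -> Omega -> R) w : \prod_(u <- labels n N) g u w =
      \1_setT w * \prod_(u <- [::]) f u w * \prod_(u <- labels n N) g u w.
    by rewrite big_nil indicT !mul1r.
  under eq_Rintegral do rewrite (one brood (fun u w =>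
    if u \in generation c n w then brood u w else 1)).
  under [RHS]eq_Rintegral do rewrite (one (fun u w => offspring_map (X u w))
    (fun u w => if u \in generation c n w then offspring_map (X u w) else 1)).
  by apply: branching_born => //; [exact: labels_uniq|exact: size_labels].
by rewrite E in cl; exact: (@norm_cvg_unique _ _ _ _ _ _ cl cr).
Qed.

End branching_property.

(** * Point measures *)

Lemma cvg_sum_seq (R : realType) (I : Type) (s : seq I) (F : I -> nat -> R) l :
  (forall i, F i @ \oo --> l i) ->
  (fun n => \sum_(i <- s) F i n) @ \oo --> \sum_(i <- s) l i.
Proof.
move=> cF; elim: s => [|i s ih].
  by rewrite big_nil; under eq_fun do rewrite big_nil; exact: cvg_cst.
rewrite big_cons; under eq_fun do rewrite big_cons.
by apply: cvgD; [exact: cF|exact: ih].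
Qed.

Section point_measures.
Context (R : realType).
Implicit Types (mu nu : pointMeasure R) (s : seq R).
Notation TR := (measurableTypeR R).

(** The convention [pm_null_off] fixes the values off the Borel sets, and the other fields are
    propositions. *)
Lemma pm_ext mu nu : (forall A, measurable A -> mu A = nu A) -> mu = nu.
Proof.
move=> munu.
have /eq_measure E : (mu : set TR -> \bar R) = nu.
  apply/funext => A; have [/munu//|mA] := pselect (measurable A).
  by rewrite !pm_null_off.
case: mu nu E {munu} => [m n0 o0] [m' n1 o1] /= E; case: _ / E n1 o1 => n1 o1.
by congr PointMeasure; exact: Prop_irrelevance.
Qed.

Definition pm_count (A : set TR) mu := Num.truncn (fine (mu A)).

Lemma pm_countE A mu : measurable A -> mu A = (pm_count A mu)%:R%:E.
Proof.
by move=> mA; have [n nE] := pm_natural mu mA; rewrite /pm_count nE /= natrK.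
Qed.

Lemma pm_fin mu : (mu setT < +oo)%E.
Proof. by rewrite pm_countE// ltry. Qed.

Lemma pm_of_seq_count s A : measurable A ->
  pm_of_seq s A = (count (fun x => x \in A) s)%:R%:E.
Proof.
move=> mA; rewrite pm_of_seqE//; under eq_bigr do rewrite diracE.
rewrite sumEFin -natr_sum; congr (_%:R%:E).
rewrite -(big_mkord predT (fun i => nat_of_bool (nth 0 s i \in A))).
rewrite -(big_nth 0 predT (fun x => nat_of_bool (x \in A))).
rewrite -sum1_count [RHS]big_mkcond /=; apply: eq_bigr => x _.
by case: (x \in A).
Qed.

Lemma pm_count_seq s A : measurable A ->
  pm_count A (pm_of_seq s) = count (fun x => x \in A) s.
Proof. by move=> mA; rewrite /pm_count pm_of_seq_count//= natrK. Qed.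

Lemma perm_pm_of_seq s s' : perm_eq s s' -> pm_of_seq s = pm_of_seq s'.
Proof.
by move=> ss'; apply: pm_ext => A mA; rewrite !pm_of_seq_count// (permP ss').
Qed.

Lemma Rintegral_pm_of_seq s (f : TR -> R) : bmf f ->
  \int[pm_of_seq s]_x f x = \sum_(x <- s) f x.
Proof.
move=> bf.
suff [] : bmf f /\ \int[pm_of_seq s]_x f x = \sum_(x <- s) f x by [].
move: f bf; apply: (@mvclass_bmf _ _ _
  [set f : TR -> R | bmf f /\ \int[pm_of_seq s]_x f x = \sum_(x <- s) f x]).
  split=> [a f g [bf fE] [bg gE]|f_ f M bf fM cf].
    split; first exact: bmf_lin.
    rewrite (Rintegral_lin (pm_fin _))// fE gE big_split /= mulr_sumr//.
  have b n : bmf (f_ n) by case: (bf n).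
  split; first exact: bmf_lim b fM cf.
  have c1 := Rintegral_cvg (pm_fin (pm_of_seq s)) b fM cf.
  have E : (fun n => \int[pm_of_seq s]_x f_ n x) = (fun n => \sum_(x <- s) f_ n x).
    by apply/funext => n; case: (bf n).
  rewrite E in c1; apply: (@norm_cvg_unique _ _ _ _ _ _ c1).
  exact: (@cvg_sum_seq R TR s (fun x => f_ ^~ x) f cf).
move=> A mA; split; first exact: bmf_indic.
rewrite Rintegral_indic// pm_of_seq_count//= -sum1_count natr_sum big_mkcond.
by apply: eq_bigr => x _; rewrite indicE; case: (x \in A).
Qed.

Lemma V0_bounds (h : R -> R) : V0 h ->
  [/\ measurable_fun [set: TR] (h : TR -> R) &
    exists2 e, 0 < e & forall x, e <= h x <= 1].
Proof.
move=> [mh h0 h1]; split; first exact: mh.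
exists (inf (range h)) => // x; rewrite h1 andbT; apply: ge_inf; last by exists x.
(* Without a lower bound the [inf] would take its default value 0, against [h0]. *)
apply: contrapT => hn; move: h0; rewrite inf_out ?ltxx// => -[_ ?]; exact: hn.
Qed.

Lemma V0_intro (h : R -> R) e : measurable_fun [set: TR] (h : TR -> R) ->
  0 < e -> (forall x, e <= h x <= 1) -> V0 h.
Proof.
move=> mh e0 h1; split; [exact: mh| |by move=> x; case/andP: (h1 x)].
apply: lt_le_trans e0 _; apply: lb_le_inf; first by exists (h 0), 0.
by move=> _ [x _ <-]; case/andP: (h1 x).
Qed.

Lemma V0_01 (h : R -> R) : V0 h -> forall x, 0 <= h x <= 1.
Proof.
by move=> /V0_bounds[_ [e e0 he]] x; have /andP[/(lt_le_trans e0)/ltW -> ->] := he x.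
Qed.

Lemma V0_gt0 (h : R -> R) x : V0 h -> 0 < h x.
Proof. by move=> /V0_bounds[_ [e e0 /(_ x)/andP[/(lt_le_trans e0)]]]. Qed.

Lemma V0_ln (h : R -> R) : V0 h -> bmf (fun x : TR => ln (h x)).
Proof.
move=> /V0_bounds[mh [e e0 he]]; split.
  by apply: measurableT_comp mh; exact: measurable_ln.
exists (- ln e) => x; have /andP[ex x1] := he x.
rewrite ler0_norm ?lerN2 ?ln_le0// ler_ln// posrE//.
exact: lt_le_trans ex.
Qed.

Lemma exp_log_seq s (h : R -> R) : V0 h ->
  exp_log (pm_of_seq s) h = \prod_(x <- s) h x.
Proof.
move=> h0; rewrite /exp_log Rintegral_pm_of_seq; last exact: V0_ln.
elim: s => [|x s ih]; first by rewrite !big_nil expR0.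
by rewrite !big_cons expRD ih lnK// posrE V0_gt0.
Qed.

End point_measures.

(** In a sorted list the entries at most [t] form an initial segment. Counts on half-lines thus
    locate each atom in order. *)
Lemma sorted_count_le (R : realType) (s : seq R) (t : R) i :
  sorted <=%O s -> (i < size s)%N ->
  (i < count (fun x => (x <= t)%R) s)%N = (nth 0 s i <= t).
Proof.
elim: s i => // x s ih i /= xs; have ss := path_sorted xs.
have [xt|tx] := leP x t.
  by case: i => [|i] /= ?; rewrite ?xt// add1n ltnS ih.
rewrite add0n => si; have xi : x <= nth 0 (x :: s) i.
  case: i si => //= i si; move: xs.
  rewrite (path_sortedE le_trans) => /andP[/allP xall _].
  by apply: xall; exact: mem_nth.
rewrite leNgt (lt_le_trans tx xi); apply/negbTE.
suff /eqP -> : count (fun y => y <= t) s == 0%N by [].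
rewrite -leqn0 leqNgt -has_count; apply/hasPn => y ys.
move: xs; rewrite (path_sortedE le_trans) => /andP[/allP xall _].
by rewrite -ltNge; apply: lt_le_trans tx _; exact: xall.
Qed.

(** * Borel sets of the weak topology and events given by counts *)

Section weak_topology_of_point_measures.
Context (R : realType).
Implicit Types (mu nu : pointMeasure R) (s : seq R).
Notation TR := (measurableTypeR R).

Lemma bounded_continuous_bmf (g : R -> R) : bounded_continuous g ->
  bmf (g : TR -> R).
Proof.
by move=> [cg bg]; split; [exact: continuous_measurable_fun|exact: bg].
Qed.

Definition pm_close e s s' :=
  size s' = size s /\ forall i, (i < size s)%N -> `|nth 0 s' i - nth 0 s i| < e.

Lemma continuous_sum_close (g : R -> R) s (e : R) : continuous g -> 0 < e ->
  exists2 r, 0 < r &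
    forall s', pm_close r s s' -> `|\sum_(x <- s') g x - \sum_(x <- s) g x| < e.
Proof.
move=> cg; elim: s e => [|x s ih] e e0.
  exists 1 => // s' [/size0nil -> _].
  by rewrite !big_nil subrr normr0.
have e20 : 0 < e / 2 by rewrite divr_gt0.
have [r r0 hr] := ih (e / 2) e20.
have /cvgrPdist_lt/(_ _ e20)[q /= q0 hq] := cg x.
exists (Num.min r q); first by rewrite lt_min r0.
move=> [|y s'] [] //= [ss'] cl; rewrite !big_cons opprD addrACA.
apply: le_lt_trans (ler_normD _ _) _; rewrite [e]splitr; apply: ltrD.
  rewrite distrC; apply: hq => /=; rewrite distrC.
  by have := cl 0%N isT => /=; rewrite lt_min => /andP[].
apply: hr; split=> // i si; have := cl i.+1 si => /=.
by rewrite lt_min => /andP[].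
Qed.

Lemma open_subbase (O : set (pointMeasure R)) mu : open O -> O mu ->
  exists2 l : seq ((R -> R) * set R),
    (forall i, i \in l -> [/\ bounded_continuous i.1, open i.2 &
      i.2 (\int[mu]_x i.1 x)]) &
    forall nu, (forall i, i \in l -> i.2 (\int[nu]_x i.1 x)) -> O nu.
Proof.
move=> [D' sD <-] [A DA Amu]; have [F sF AE] := sD _ DA.
exists (finmap.enum_fset F) => [i iF|nu nuF].
  have := sF i iF; rewrite inE => -[bi oi]; split=> //.
  by move: Amu; rewrite -AE => /(_ i iF).
exists A => //; suff : (A : set (pointMeasure R)) nu by [].
by rewrite -AE => i iF; exact: (nuF i iF).
Qed.

(** A basic open set constrains finitely many integrals of continuous functions, and each of them is
    a finite sum that depends continuously on the atoms. *)
Lemma open_close (O : set (pointMeasure R)) s : open O -> O (pm_of_seq s) ->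
  exists2 r, 0 < r & forall s', pm_close r s s' -> O (pm_of_seq s').
Proof.
move=> oO /(open_subbase oO)[l hl hO].
suff [r r0 hr] : exists2 r, 0 < r & forall s', pm_close r s s' ->
    forall i, i \in l -> i.2 (\int[pm_of_seq s']_x i.1 x).
  by exists r => // s' ss'; apply: hO; exact: hr.
elim: l hl {hO} => [_|i l ih hl]; first by exists 1.
have [j jl|r r0 hr] := ih; first by apply: hl; rewrite inE jl orbT.
have [bci oi] := hl i (mem_head _ _).
rewrite Rintegral_pm_of_seq; last exact: bounded_continuous_bmf.
move=> is_; have /nbhs_ballP[e /= e0 be] := open_nbhs_nbhs (conj oi is_).
have [q q0 hq] := continuous_sum_close s bci.1 e0.
exists (Num.min r q); first by rewrite lt_min r0.
move=> s' [ss' cl] j; rewrite inE => /predU1P[->|jl].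
  rewrite Rintegral_pm_of_seq; last exact: bounded_continuous_bmf.
  apply: be; rewrite -ball_normE /= distrC; apply: hq; split=> // k ks.
  by have := cl k ks; rewrite lt_min => /andP[].
apply: hr => //; split=> // k ks.
by have := cl k ks; rewrite lt_min => /andP[].
Qed.

Definition count_events : set (set (pointMeasure R)) :=
  [set E | exists A j, measurable A /\ E = [set mu | pm_count A mu = j]].

(** The null measure is included, so that the law of a population, extinct or not, lives here;
    [nz_image_measurable] brings the Borel sets of [nzPointMeasure] into it. *)
Definition PM := g_sigma_algebraType count_events.

Lemma measurable_count (A : set TR) (J : set nat) : measurable A ->
  measurable [set mu : PM | J (pm_count A mu)].
Proof.
move=> mA; rewrite (_ : [set mu | _] =
  \bigcup_(j in J) [set mu : PM | pm_count A mu = j]).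
  apply: bigcup_measurable => j _; apply: sub_sigma_algebra.
  by exists A, j.
by apply/seteqP; split => [mu Jmu|mu [j Jj /= ->]//]; exists (pm_count A mu).
Qed.

Let half_line (q : rat) : set TR := [set` `]-oo, ratr q]].

Let m_half_line q : measurable (half_line q).
Proof. exact: measurable_itv. Qed.

(* On a point measure with ordered atoms [x_0 <= ... <= x_(k - 1)] these
   conditions say that [x_i] lies in the half-open interval from [a_i] to [b_i]. *)
Definition rational_box (x : nat * (seq rat * seq rat)) : set PM :=
  [set mu | pm_count setT mu = x.1] `&` \bigcap_(i in `I_x.1)
    ([set mu | (pm_count (half_line (nth (0 : rat) x.2.1 i)) mu <= i)%N] `&`
     [set mu | (i < pm_count (half_line (nth (0 : rat) x.2.2 i)) mu)%N]).

Lemma measurable_rational_box x : measurable (rational_box x).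
Proof.
apply: measurableI; first exact: (measurable_count (fun j => j = x.1)).
apply: bigcap_measurableType => i _; apply: measurableI.
  exact: (measurable_count (fun j => (j <= i)%N)).
exact: (measurable_count (fun j => (i < j)%N)).
Qed.

Lemma rational_boxE s x : sorted <=%O s ->
  rational_box x (pm_of_seq s : PM) <-> size s = x.1 /\
    forall i, (i < x.1)%N ->
      ratr (nth (0 : rat) x.2.1 i) < nth (0 : R) s i <= ratr (nth (0 : rat) x.2.2 i).
Proof.
move=> ss; have sT : pm_count setT (pm_of_seq s) = size s.
  rewrite pm_count_seq//; apply/eqP; rewrite -all_count.
  by apply/allP => ? _; rewrite inE.
have sh q i : (i < size s)%N ->
    (i < pm_count (half_line q) (pm_of_seq s))%N = (nth 0 s i <= ratr q).
  move=> si; rewrite pm_count_seq// -sorted_count_le//; congr (_ < _)%N.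
  by apply: eq_count => y; rewrite /half_line mem_setE in_itv.
rewrite /rational_box /= sT; split=> -[sx H]; split=> // i ix.
  have [] := H i ix; rewrite /= leqNgt !sh ?sx// -ltNge => -> ->//.
by have /andP[] := H i ix; rewrite /= leqNgt !sh ?sx// -ltNge => -> ->.
Qed.

Hypothesis atomic : forall mu, exists s, mu = pm_of_seq s.

Lemma sorted_atomic mu : exists2 s, sorted <=%O s & mu = pm_of_seq s.
Proof.
have [s ->] := atomic mu; exists (sort <=%O s); first exact: sort_sorted le_total _.
by apply: perm_pm_of_seq; rewrite perm_sym perm_sort.
Qed.

Lemma open_count_measurable (O : set (pointMeasure R)) :
  open O -> measurable (O : set PM).
Proof.
move=> oO.
(* Boxes not contained in [O] are replaced by the empty set, so that the union runs over a whole
   countable type. *)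
rewrite (_ : (O : set PM) =
  \bigcup_x (if `[< rational_box x `<=` O >] then rational_box x else set0)).
  apply: countable_bigcupT_measurable => // x.
  by case: ifP => // _; exact: measurable_rational_box.
apply/seteqP; split => [mu|mu [x _]]; last by case: ifP => // /asboolP; apply.
have [s ss ->] := sorted_atomic mu => /(open_close oO)[r r0 hr].
(* Rationals within [r] of the i-th atom, [f i] below and [g i] above it: each ordered atom of a
   measure in the box is then closer than [r] to the matching atom of [s]. *)
have /choice[f hf] i : exists q : rat, ratr q \in `]nth 0 s i - r, nth 0 s i[.
  by apply: rat_in_itvoo; rewrite ltrBlDr ltrDl.
have /choice[g hg] i : exists q : rat, ratr q \in `]nth 0 s i, nth 0 s i + r[.
  by apply: rat_in_itvoo; rewrite ltrDl.
pose x := (size s, (mkseq f (size s), mkseq g (size s))).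
have xO : rational_box x `<=` O.
  move=> nu; have [s' ss' ->] := sorted_atomic nu => /(rational_boxE _ ss')[/= sx H].
  apply: hr; split=> // i si; have := H i si; rewrite !nth_mkseq//.
  have := hf i; have := hg i; rewrite !in_itv /= ltr_distl.
  move=> /andP[_ gr] /andP[fr _] /andP[fs sg].
  by rewrite (lt_trans fr fs) (le_lt_trans sg gr).
exists x => //; rewrite (asboolT xO); apply: (rational_boxE x ss).2.
split=> // i /= si; rewrite !nth_mkseq//.
have := hf i; have := hg i; rewrite !in_itv /= => /andP[/ltW -> _] /andP[_ ->].
by [].
Qed.

Lemma null_count_measurable : measurable ([set null_pm R] : set PM).
Proof.
rewrite (_ : [set null_pm R] = [set mu : PM | pm_count setT mu = 0%N]).
  exact: (measurable_count (fun j => j = 0%N)).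
apply/seteqP; split => [mu ->|mu] /=; first by rewrite pm_count_seq.
have [s ->] := atomic mu; rewrite pm_count_seq// => s0.
congr pm_of_seq; apply: size0nil; rewrite -s0.
by apply/esym/eqP; rewrite -all_count; apply/allP => ? _; rewrite inE.
Qed.

Lemma nz_val_inj : injective (@nz_val R).
Proof. exact: val_inj. Qed.

Lemma nz_val_neq0 (mu : nzPointMeasure R) : nz_val mu <> null_pm R.
Proof. by have := set_valP mu; exact. Qed.

Lemma nz_val_surj mu : mu <> null_pm R ->
  exists nu : nzPointMeasure R, nz_val nu = mu.
Proof. by move=> mu0; exists (exist _ mu (mem_set mu0)). Qed.

(** The Borel sets are generated by traces of weakly open sets. As [nz_val] is injective and misses
    only the null measure, taking images commutes with complements once that point is removed. *)
Lemma nz_image_measurable (B : set (nzPointMeasure R)) :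
  measurable B -> measurable (@nz_val R @` B : set PM).
Proof.
move=> mB; have : <<s (@open (nzPointMeasure R)) >> B by exact: mB.
move: B {mB}.
apply: (@smallest_sub _ _ _ [set B | measurable (@nz_val R @` B : set PM)]).
  split=> [|A mA|F mF] /=.
  - by rewrite image_set0.
  - rewrite (_ : _ @` _ = ~` [set null_pm R] `\` (@nz_val R @` A)).
      apply: measurableD => //; apply: measurableC.
      exact: null_count_measurable.
    apply/seteqP; split => [_ [mu [_ nA] <-]|mu [mu0 nA]].
      split; first exact: nz_val_neq0.
      by move=> [nu Anu /nz_val_inj nuE]; apply: nA; rewrite -nuE.
    have [nu nuE] := nz_val_surj mu0; exists nu => //; split=> // Anu.
    by apply: nA; exists nu.
  - by rewrite image_bigcup; apply: bigcupT_measurable.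
move=> _ [V oV <-]; rewrite /= (_ : _ @` _ = V `\` [set null_pm R]).
  by apply: measurableD; [exact: open_count_measurable|exact: null_count_measurable].
apply/seteqP; split=> [_ [mu Vmu <-]|mu [Vmu mu0]].
  by split; [exact: Vmu|exact: nz_val_neq0].
by have [nu nuE] := nz_val_surj mu0; exists nu => //; move: Vmu; rewrite -nuE.
Qed.

End weak_topology_of_point_measures.

(** * Integrals of bounded functions depend measurably on the point measure *)

Section integration_against_point_measures.
Context (R : realType).
Notation TR := (measurableTypeR R).

Let pm_integral (g : TR -> R) (mu : nzPointMeasure R) := \int[nz_val mu]_x g x.

Let integral_class :
  mvclass [set g : TR -> R | bmf g /\
    measurable_fun [set: nzPointMeasure R] (pm_integral g)].
Proof.
split=> [a f g [bf mf] [bg mg]|f_ f M bf fM cf].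
  split; first exact: bmf_lin.
  rewrite (_ : pm_integral _ = fun mu => a * pm_integral f mu + pm_integral g mu);
    last first.
    by apply/funext => mu; exact: (Rintegral_lin (pm_fin _)).
  by apply: measurable_funD => //; exact: measurable_funM.
have b n : bmf (f_ n) by case: (bf n).
split; first exact: bmf_lim b fM cf.
apply: (measurable_fun_cvg (h := fun n => pm_integral (f_ n))).
  by move=> n; case: (bf n).
by move=> mu _; exact: (Rintegral_cvg (pm_fin _) b fM cf).
Qed.

Let integral_continuous (g : R -> R) : bounded_continuous g ->
  measurable_fun [set: nzPointMeasure R] (pm_integral g).
Proof.
move=> bg.
apply: (measurability _ (RGenOInfty.measurableE R)).
move=> _ [_ [x ->] <-]; rewrite setTI; apply: sub_sigma_algebra.
exists [set mu : pointMeasure R | `]x, +oo[%classic (\int[mu]_x g x)] => //.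
exists [set [set mu : pointMeasure R | `]x, +oo[%classic (\int[mu]_x g x)]]; last first.
  by rewrite bigcup_set1.
move=> _ ->; apply: (@finI_from1 _ _
  [set i : (R -> R) * set R | bounded_continuous i.1 /\ open i.2]
  (fun i => [set mu : pointMeasure R | i.2 (\int[mu]_x i.1 x)])
  (g, `]x, +oo[%classic)).
by split=> //; exact: interval_open.
Qed.

(** Continuous, equal to 1 up to [t] and less than 1 beyond: [1 - decay t x ^+ n] stays in [0, 1]
    and tends to the indicator of the open half-line after [t]. *)
Let decay (t x : R) := expR (- (`|x - t| + (x - t))).

Let decay_itv t x : 0 <= decay t x <= 1.
Proof.
rewrite expR_ge0 /= -expR0 ler_expR oppr_le0.
by have := ler_norm (- (x - t)); rewrite normrN -subr_ge0 opprK.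
Qed.

Let decay_continuous t n : bounded_continuous (fun x => decay t x ^+ n).
Proof.
split; last first.
  exists 1 => x; have /andP[d0 d1] := decay_itv t x.
  by rewrite ger0_norm ?exprn_ge0// exprn_ile1.
move=> x; apply: (@continuous_comp _ _ _ (decay t) (fun y => y ^+ n));
  last exact: exprn_continuous.
apply: continuous_comp; last exact: continuous_expR.
apply: continuousN; apply: continuousD.
  apply: continuous_comp; last exact: norm_continuous.
  by apply: continuousB; [exact: cvg_id|exact: cvg_cst].
by apply: continuousB; [exact: cvg_id|exact: cvg_cst].
Qed.

Let decay_cvg (t x : R) :
  (fun n => 1 - decay t x ^+ n) @ \oo --> (\1_`]t, +oo[%classic x : R).
Proof.
rewrite indicE mem_setE in_itv /= andbT; case: ltP => tx /=.
  rewrite -[X in _ --> X]subr0; apply: cvgB; first exact: cvg_cst.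
  have /andP[d0 _] := decay_itv t x.
  apply: cvg_expr; rewrite ger0_norm// /decay -expR0 ltr_expR oppr_lt0.
  by rewrite ltr_wpDl// subr_gt0.
rewrite -[X in _ --> X](subrr 1); apply: cvgB; first exact: cvg_cst.
rewrite /decay ler0_norm ?subr_le0// addNr oppr0 expR0.
by apply: cvg_near_cst; apply: nearW => n; rewrite expr1n.
Qed.

(** Bounded continuous functions are covered by the definition of the topology, half-lines by
    [decay], Borel sets because half-lines are stable under intersection, and bounded functions by
    linearity and limits. *)
Lemma measurable_Rintegral_pm (g : TR -> R) : bmf g ->
  measurable_fun [set: nzPointMeasure R] (fun mu => \int[nz_val mu]_x g x).
Proof.
move=> bg; suff [] : bmf g /\
  measurable_fun [set: nzPointMeasure R] (pm_integral g) by [].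
move: g bg; apply: (mvclass_bmf integral_class) => A.
have H1 : [set g : TR -> R | bmf g /\
    measurable_fun [set: nzPointMeasure R] (pm_integral g)] (fun=> 1).
  split; first exact: bmf_cst.
  by apply: integral_continuous; split; [exact: cst_continuous|exists 1 => x; rewrite normr1].
move=> mA.
have {mA} : (@RGenOInfty.G R).-sigma.-measurable A.
  by rewrite -RGenOInfty.measurableE.
move: A; apply: (mvclass_sigma integral_class _ H1).
  move=> _ _ [x ->] [y ->]; exists (Num.max x y).
  by apply/seteqP; split => z /=; rewrite !in_itv /= !andbT gt_max => /andP.
move=> _ [t ->].
apply: (integral_class.2 (fun n x => 1 - decay t x ^+ n) _ 1).
- move=> n; apply: (mvclassB integral_class) => //; split.
    exact: (bounded_continuous_bmf (decay_continuous t n)).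
  exact: (integral_continuous (decay_continuous t n)).
- move=> n x; have /andP[d0 d1] := decay_itv t x.
  by rewrite ger0_norm ?subr_ge0 ?exprn_ile1// lerBlDr lerDl exprn_ge0.
- exact: decay_cvg.
Qed.

Lemma measurable_exp_log (h : R -> R) : V0 h ->
  measurable_fun [set: nzPointMeasure R] (fun mu => exp_log (nz_val mu) h).
Proof.
move=> /V0_ln bh; apply: measurableT_comp; first exact: measurable_expR.
exact: measurable_Rintegral_pm.
Qed.

End integration_against_point_measures.

(** Extraction of a coefficient of a power series in r. By strong induction the terms of degree
    below [n] may be subtracted; after division by r^n there remains [f x * r ^+ (N x - n)] where
    [N x >= n], and r = 1/(k+1) tends to 0. The quotient keeps the bound [M]. *)
Lemma mvclass_level (S : Type) (R : realType) (H : set (S -> R)) (f : S -> R)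
    (N : S -> nat) M : mvclass H -> (forall x, `|f x| <= M) ->
  (forall r, 0 < r <= 1 -> H (fun x => f x * r ^+ N x)) ->
  forall n, H (fun x => f x * (N x == n)%:R).
Proof.
move=> vH fM Hr; elim/ltn_ind => n ih.
pose r k : R := k.+1%:R^-1.
have r0 k : 0 < r k by rewrite invr_gt0.
have r1 k : r k <= 1 by rewrite invf_le1// ler1n.
have cr : r @ \oo --> (0 : R) by exact: cvg_harmonic.
have H0 : H (fun=> 0) by apply: (mvclass0 vH (Hr 1 _)); rewrite ltr01 lexx.
pose g k x := (r k)^-1 ^+ n * (f x * r k ^+ N x -
   \sum_(j < n) r k ^+ j * (f x * (N x == j)%:R)).
have gE k x : g k x = if (N x < n)%N then 0 else f x * r k ^+ (N x - n).
  have rk0 : r k != 0 by exact: lt0r_neq0.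
  rewrite /g; case: ltnP => Nn.
    rewrite (bigD1 (Ordinal Nn))//= eqxx mulr1 big1 => [|j jN].
      by rewrite addr0 [X in _ - X]mulrC subrr mulr0.
    have /negbTE -> : N x != j.
      by apply: contra jN => /eqP E; apply/eqP/val_inj; rewrite /= E.
    by rewrite !mulr0.
  rewrite big1 => [|j _]; last by rewrite gtn_eqF ?mulr0// (leq_trans (ltn_ord j)).
  rewrite subr0 mulrCA -{1}(subnK Nn) exprD; congr (_ * _).
  by rewrite mulrCA -exprMn mulVf// expr1n mulr1.
apply: (vH.2 g _ M) => [k|k x|x].
- apply: (mvclassZ vH); apply: (mvclassB vH); first by apply: Hr; rewrite r0 r1.
  by apply: (mvclass_sum vH) => // j; apply: (mvclassZ vH); exact: ih.
- rewrite gE; case: ifP => _; first by rewrite normr0 (le_trans _ (fM x)).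
  rewrite normrM (le_trans _ (fM x))// ler_piMr//.
  by rewrite ger0_norm ?exprn_ge0 ?exprn_ile1// ltW.
- under eq_fun do rewrite gE; case: ltngtP => Nn.
  + by rewrite mulr0; exact: cvg_cst.
  + apply: cvgM; first exact: cvg_cst.
    rewrite -(prednK (n := N x - n)) ?subn_gt0//.
    apply: (@squeeze_cvgr _ _ _ _ (fun=> 0) r) => //; last exact: cvg_cst.
    apply: nearW => k; have rk0 := ltW (r0 k).
    by rewrite exprn_ge0//= exprS ler_piMr// exprn_ile1.
  + by rewrite Nn subnn; under eq_fun do rewrite expr0; exact: cvg_cst.
Qed.

(** * Generating functionals determine the laws of point measures *)

Section laws_of_point_processes.
Context (R : realType).
Notation TR := (measurableTypeR R).

Lemma V0_1 : V0 (fun=> 1 : R).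
Proof. by apply: (V0_intro (e := 1)) => //; rewrite lexx. Qed.

Lemma exp_log_1 (mu : pointMeasure R) : exp_log mu (fun=> 1) = 1.
Proof.
rewrite /exp_log (_ : (fun=> _) = fun=> 0); last by apply/funext => x; rewrite ln1.
by rewrite Rintegral_cst// mul0r expR0.
Qed.

Lemma exp_log_01 (mu : pointMeasure R) (h : R -> R) : V0 h -> 0 <= exp_log mu h <= 1.
Proof.
move=> Vh; rewrite expR_ge0 /= -[leRHS](exp_log_1 mu) ler_expR.
apply: (Rintegral_le (pm_fin mu)); [exact: V0_ln|exact: (V0_ln V0_1)|].
by move=> x; rewrite ln1 ln_le0//; case/andP: (V0_01 Vh x).
Qed.

Lemma V0_scale (h : R -> R) (A : set TR) r : V0 h -> measurable A -> 0 < r <= 1 ->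
  V0 (fun x => h x * r ^+ (x \in A)).
Proof.
move=> /V0_bounds[mh [e e0 he]] mA /andP[r0 r1].
apply: (V0_intro (e := e * r)); last 2 first.
- exact: mulr_gt0.
- move=> x; have /andP[ex x1] := he x.
  have rA : r <= r ^+ (x \in A) <= 1 by case: (x \in A); rewrite ?lexx ?r1.
  have /andP[ra a1] := rA.
  have hx0 : 0 <= h x by exact: le_trans (ltW e0) ex.
  have ra0 : 0 <= r ^+ (x \in A) by exact: le_trans (ltW r0) ra.
  by apply/andP; split; [apply: ler_pM => //; exact: ltW|exact: mulr_ile1].
apply: measurable_funM => //.
rewrite (_ : (fun x => _) = (fun x : TR => (r - 1) * \1_A x + 1)).
  by have [] := bmf_lin (r - 1) (bmf_indic R mA) (bmf_cst TR 1).
apply/funext => x; rewrite indicE.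
by case: (x \in A); rewrite ?mulr1 ?mulr0 ?subrK ?add0r.
Qed.

Lemma exp_log_scale (mu : pointMeasure R) (h : R -> R) (A : set TR) r :
  V0 h -> measurable A -> 0 < r <= 1 ->
  exp_log mu (fun x => h x * r ^+ (x \in A)) = exp_log mu h * r ^+ pm_count A mu.
Proof.
move=> Vh mA /andP[r0 r1]; rewrite /exp_log.
transitivity (expR (\int[mu]_x (ln r * \1_A (x : TR) + ln (h x)))).
  congr expR; apply: eq_Rintegral => x _.
  rewrite lnM ?posrE ?exprn_gt0 ?(V0_gt0 x Vh)//.
  by rewrite lnXn// addrC indicE mulr_natr.
have -> := Rintegral_lin (pm_fin mu) (ln r) (bmf_indic R mA) (V0_ln Vh).
rewrite Rintegral_indic// pm_countE//= expRD mulrC; congr (_ * _).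
by rewrite mulrC expRM_natl lnK.
Qed.

Lemma measurable_exp_log_count (h : R -> R) : V0 h ->
  measurable_fun [set: PM R] (fun mu => exp_log (mu : pointMeasure R) h).
Proof.
move=> /V0_ln bh; apply: measurableT_comp; first exact: measurable_expR.
apply: (measurable_Rintegral_kernel (k := fun mu : PM R => pm_measure mu)) bh.
  by move=> mu; exact: pm_fin.
move=> A mA _ Y mY; rewrite setTI.
have := measurable_count [set j | Y (j%:R%:E)] mA; congr measurable.
by apply/seteqP; split => mu /=; rewrite (pm_countE mu mA).
Qed.

(* The generating functionals separate the laws of point measures: scaling [h]
   by [r] on [A] turns [exp_log mu h] into [r ^+ mu A * exp_log mu h], a power
   series in [r] from which the event [mu A = j] is extracted. *)
Lemma mvclass_count_events (H : set (PM R -> R)) : mvclass H ->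
  (forall h, V0 h -> H (fun mu => exp_log (mu : pointMeasure R) h)) ->
  forall C : set (PM R), measurable C -> H \1_C.
Proof.
move=> vH Hexp.
pose D (l : seq (set TR * nat)) : set (PM R) :=
  [set mu | forall i, i \in l -> pm_count i.1 mu = i.2].
have DE l mu : \prod_(i <- l) (pm_count i.1 mu == i.2)%:R = \1_(D l) mu :> R.
  rewrite indicE; elim: l => [|i l ih]; first by rewrite big_nil mem_set.
  rewrite big_cons ih -natrM mulnb; congr (_%:R); congr nat_of_bool.
  apply/andP/idP => [[/eqP il /set_mem Dl]|/set_mem Dl].
    by apply/mem_set => j; rewrite inE => /predU1P[->|/Dl].
  split; first by apply/eqP; apply: Dl; exact: mem_head.
  by apply/mem_set => j jl; apply: Dl; rewrite inE jl orbT.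
(* All of [V0] is treated at once, since scaling on the next set [A] replaces [h] by another
   function of [V0]. *)
have HD l : (forall i, i \in l -> measurable i.1) ->
    forall h, V0 h -> H (fun mu => exp_log (mu : pointMeasure R) h * \1_(D l) mu).
  elim: l => [|[A n] l ih] ml h Vh.
    rewrite (_ : (fun mu => _) = fun mu => exp_log (mu : pointMeasure R) h).
      exact: Hexp.
    by apply/funext => mu; rewrite -DE big_nil mulr1.
  have mA : measurable A by exact: (ml (A, n) (mem_head _ _)).
  have ml' i : i \in l -> measurable i.1 by move=> il; apply: ml; rewrite inE il orbT.
  rewrite (_ : (fun mu => _) = fun mu =>
    (exp_log (mu : pointMeasure R) h * \1_(D l) mu) * (pm_count A mu == n)%:R).
    apply: (mvclass_level (M := 1)) => // [mu|r r01].
      have /andP[e0 e1] := exp_log_01 mu Vh.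
      have /andP[i0 i1] : 0 <= (\1_(D l) mu : R) <= 1.
        by rewrite indicE; case: (_ \in _); rewrite ?ler01 ?lexx.
      by rewrite ger0_norm ?mulr_ge0// mulr_ile1.
    have := ih ml' _ (V0_scale Vh mA r01); congr H; apply/funext => mu.
    by rewrite exp_log_scale// mulrAC.
  by apply/funext => mu; rewrite -!DE big_cons /= -mulrA; congr (_ * _); rewrite mulrC.
pose G := [set E | exists2 l : seq (set TR * nat),
  (forall i, i \in l -> measurable i.1) & E = D l].
move=> C mC; apply: (@mvclass_sigma _ _ H vH G).
- move=> _ _ [l ml ->] [l' ml' ->]; exists (l ++ l').
    by move=> i; rewrite mem_cat => /orP[/ml|/ml'].
  apply/seteqP; split => mu /= => [[Dl Dl'] i|Dl].
    by rewrite mem_cat => /orP[/Dl|/Dl'].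
  by split=> i il; apply: Dl; rewrite mem_cat il ?orbT.
- have := Hexp _ V0_1; congr H; apply/funext => mu; exact: exp_log_1.
- move=> _ [l ml ->]; have := HD l ml _ V0_1; congr H; apply/funext => mu.
  by rewrite exp_log_1 mul1r.
move: C mC; apply: smallest_sub; first exact: smallest_sigma_algebra.
move=> _ [A [j [mA ->]]]; apply: sub_gen_smallest; exists [:: (A, j)].
  by move=> i; rewrite inE => /eqP ->.
apply/seteqP; split => mu /=; first by move=> Aj i; rewrite inE => /eqP ->.
by move=> /(_ (A, j)); apply; exact: mem_head.
Qed.

End laws_of_point_processes.

(** * Particle systems *)

Lemma ae_eq_Rintegral d (T : measurableType d) (R : realType)
    (mu : {measure set T -> \bar R}) (f g : T -> R) :
  bmf f -> bmf g -> {ae mu, forall x, f x = g x} ->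
  \int[mu]_x f x = \int[mu]_x g x.
Proof.
move=> [mf _] [mg _] fg; congr fine; apply: ae_eq_integral => //.
- exact/measurable_EFinP.
- exact/measurable_EFinP.
- by apply: filterS fg => x + _ => ->.
Qed.

Section particle_system.
Context d (Omega : measurableType d) (R : realType) (S : particleSystem Omega R).
Variable h : measurableTypeR R -> R.
Hypotheses (mh : measurable_fun [set: measurableTypeR R] h)
  (h01 : forall y, 0 <= h y <= 1).

(** The list behind [population]. Unlike [exp_log], a product over it makes sense for a function
    that vanishes. *)
Definition atoms n w : seq R := flatten
  [seq [seq position S i u w | u <- generation (children S i) n w]
    | i <- iota 0 (ancestors S w)].

Definition tree_prod i n w :=
  \prod_(u <- generation (children S i) n w) h (position S i u w).

Lemma prod_atoms n w :
  \prod_(x <- atoms n w) h x = \prod_(i <- iota 0 (ancestors S w)) tree_prod i n w.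
Proof. by rewrite big_flatten big_map; apply: eq_bigr => i _; rewrite big_map. Qed.

Lemma tree_prod_01 i n w : 0 <= tree_prod i n w <= 1.
Proof.
rewrite prodr_ge0 => [|u _]; last by case/andP: (h01 (position S i u w)).
by apply: prodr_ile1 => u _.
Qed.

Let mc i u : measurable_fun [set: Omega] (children S i u).
Proof. exact: measurable_funPT. Qed.

Let mX i u : measurable_fun [set: Omega] (position S i u).
Proof. exact: measurable_funPT. Qed.

Lemma bmf_tree_prod i n : bmf (tree_prod i n).
Proof.
apply: bmf_01 (tree_prod_01 i n).
apply: (@measurable_prod_generation _ _ _ (children S i)
  (fun u w => h (position S i u w))) => u Y mY.
apply: measurableI; first exact: (measurable_born (mc i)).
rewrite -[X in measurable X]setTI; apply: (measurableT_comp mh (mX i u)) => //.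
Qed.

Let Gen i : set (set Omega) := [set E | exists u (B : set (measurableTypeR R)),
  [/\ setT u, measurable B & E = born (children S i) u `&` position S i u @^-1` B] ].

(** Independence of the trees is assumed for genealogical events only, so measurability on [Omega]
    would not suffice. *)
Lemma tree_prod_genealogy i n :
  measurable_fun [set: g_sigma_algebraType (Gen i)] (tree_prod i n).
Proof.
apply: (@measurable_prod_generation _ (g_sigma_algebraType (Gen i)) R (children S i)
  (fun u w => h (position S i u w))) => u Y mY.
apply: sub_sigma_algebra; exists u, (h @^-1` Y); split=> //.
by rewrite -[X in measurable X]setTI; exact: mh.
Qed.

Lemma bmf_prod_atoms n : bmf (fun w => \prod_(x <- atoms n w) h x).
Proof.
have t01 w i : 0 <= (if (i < ancestors S w)%N then tree_prod i n w else 1) <= 1.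
  by case: ifP => _; [exact: tree_prod_01|rewrite ler01 lexx].
apply: (@bmf_lim _ _ _ (fun N w => \prod_(i <- iota 0 N)
    (if (i < ancestors S w)%N then tree_prod i n w else 1)) _ 1) => [N|N w|w].
- apply: bmf_prod => i _.
  rewrite (_ : (fun w => _) = fun w =>
     \1_(ancestors S @^-1` [set k | (i < k)%N]) w * tree_prod i n w +
     \1_(ancestors S @^-1` [set k | (k <= i)%N]) w); last first.
    apply/funext => w; rewrite !indicE; case: ltnP => iw.
      by rewrite mem_set//= memNset ?mul1r ?addr0//= leqNgt iw.
    by rewrite memNset ?mul0r ?add0r ?mem_set//= ltnNge iw.
  have ma (J : set nat) : measurable (ancestors S @^-1` J).
    by rewrite -[X in measurable X]setTI; exact: measurable_funPT.
  by apply: bmfD; [apply: bmfM; [exact: bmf_indic|exact: bmf_tree_prod]|exact: bmf_indic].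
- rewrite ger0_norm; first by apply: prodr_ile1.
  by apply: prodr_ge0 => i _; case/andP: (t01 w i).
- rewrite prod_atoms; apply: cvg_near_cst; exists (ancestors S w) => // N /= aN.
  rewrite -(subnKC aN) iotaD big_cat /= add0n [X in _ * X]big1_seq ?mulr1.
    by apply: eq_big_seq => i; rewrite mem_iota add0n => /andP[_ ->].
  by move=> i /andP[_]; rewrite mem_iota => /andP[/leq_gtF ->].
Qed.

Variables (p : probability nat R)
  (P : R.-pker (measurableTypeR R) ~> (measurableTypeR R)).
Variables (Pr : probability Omega R) (s : seq R).
Hypothesis Hanc : {ae Pr, forall w, ancestors S w = size s}.
Hypothesis Hind : forall A : nat -> set Omega,
  (forall i, (i < size s)%N ->
    genealogy (children S i) (position S i) setT (A i)) ->
  Pr (\bigcap_(i in `I_(size s)) A i) = (\prod_(i < size s) Pr (A i))%E.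

Let Prfin : (Pr setT < +oo)%E.
Proof. exact/total_mass1_fin/probability_setT. Qed.

Let Rintegral_Pr_cst (a : R) : \int[Pr]_w a = a.
Proof. exact/Rintegral_cst1/probability_setT. Qed.

(** Independence of events extends to bounded functions by [mvclosure_prod]: the generators pair the
    indicator of [A] with the constant [Pr A], and the closure pairs a function with its
    expectation. *)
Lemma expectation_prod_atoms n :
  \int[Pr]_w (\prod_(x <- atoms n w) h x) =
  \prod_(i <- iota 0 (size s)) \int[Pr]_w tree_prod i n w.
Proof.
transitivity (\int[Pr]_w \prod_(i <- iota 0 (size s)) tree_prod i n w).
  apply: ae_eq_Rintegral; first exact: bmf_prod_atoms.
    by apply: bmf_prod => i _; exact: bmf_tree_prod.
  by apply: filterS Hanc => w aw; rewrite prod_atoms aw.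
pose C i : set (Omega + Omega -> R) := [set f | exists2 A,
  genealogy (children S i) (position S i) setT A &
  f = on_pair (\1_A) (fun=> fine (Pr A))].
have mgen i A : genealogy (children S i) (position S i) setT A -> measurable A.
  exact: (genealogy_measurable (mc i) (mX i)).
have b1 : bmf (fun _ : Omega => 1 : R) by exact: (bmf_cst Omega 1).
transitivity (\int[Pr]_w (1 * \prod_(i <- iota 0 (size s)) tree_prod i n w)).
  by apply: eq_Rintegral => w _; rewrite mul1r.
transitivity (\int[Pr]_w (1 * \prod_(i <- iota 0 (size s))
    \int[Pr]_w tree_prod i n w)); last first.
  by rewrite Rintegral_Pr_cst mul1r.
apply: (@mvclosure_prod _ _ _ Pr Prfin _ (iota 0 (size s)) C _ _ (iota_uniq _ _) b1 b1
  _ _ (fun i => on_pair (tree_prod i n) (fun=> \int[Pr]_w tree_prod i n w))).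
- move=> i _ [A gA ->]; split; last exact: (bmf_cst Omega (fine (Pr A))).
  exact/bmf_indic/(mgen i).
- move=> f Cf.
  have /choice[A HA] i : exists A, i \in iota 0 (size s) ->
      genealogy (children S i) (position S i) setT A /\
      f i = on_pair (\1_A) (fun=> fine (Pr A)).
    have [/Cf[A gA fE]|_] := boolP (i \in iota 0 (size s)); first by exists A.
    by exists set0.
  have gA i : (i < size s)%N -> genealogy (children S i) (position S i) setT (A i).
    by move=> si; have [] := HA i; rewrite // mem_iota.
  transitivity (\int[Pr]_w \1_(\bigcap_(i in `I_(size s)) A i) w).
    apply: eq_Rintegral => w _; rewrite mul1r indic_bigcap_ord.
    rewrite -(big_mkord predT (fun i => \1_(A i) w)) /index_iota subn0.
    by apply: eq_big_seq => i /HA[_ ->].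
  rewrite Rintegral_indic; last first.
    by apply: bigcap_measurableType => i si; apply: (mgen i (A i)); exact: gA.
  transitivity (\int[Pr]_w \prod_(i <- iota 0 (size s)) fine (Pr (A i))).
    rewrite Rintegral_Pr_cst.
    transitivity (fine (\prod_(i < size s) Pr (A i))%E); first by rewrite -Hind.
    rewrite (eq_bigr (fun i : 'I_(size s) => (fine (Pr (A i)))%:E)); last first.
      by move=> i _; rewrite fineK// fin_num_measure//; apply: (mgen i (A i)); exact: gA.
    by rewrite prodEFin -(big_mkord predT (fun i => fine (Pr (A i)))) /index_iota subn0.
  apply: eq_Rintegral => w _; rewrite mul1r.
  by apply: eq_big_seq => i /HA[_ ->].
move=> i _; have vC := mvclosure_class (C i).
(* The generators are indicators of events of the i-th genealogy, so the monotone class runs over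
   [T]; measurability on [Omega] is carried along for the integrals. *)
pose T := g_sigma_algebraType (Gen i).
suff [] : [/\ @bmf _ T R (tree_prod i n), bmf (tree_prod i n) &
  mvclosure (C i) (on_pair (tree_prod i n) (fun=> \int[Pr]_w tree_prod i n w))] by [].
have : @bmf _ T R (tree_prod i n).
  exact: (@bmf_01 _ T R _ (@tree_prod_genealogy i n) (tree_prod_01 i n)).
move: (tree_prod i n); apply: (@mvclass_bmf _ T R [set f | [/\ @bmf _ T R f,
  bmf (f : Omega -> R) & mvclosure (C i) (on_pair f (fun=> \int[Pr]_w f w))]]).
  split=> [a f g [bf bf' Cf] [bg bg' Cg]|f_ f M bf fM cf].
    split; [exact: bmf_lin|exact: bmf_lin|].
    have := vC.1 a _ _ Cf Cg; congr (mvclosure _ _); apply/funext => -[w|w] //=.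
    by rewrite (Rintegral_lin Prfin).
  have b n0 : bmf (f_ n0 : Omega -> R) by case: (bf n0).
  split; [|exact: bmf_lim b fM cf|].
    by apply: (@bmf_lim _ T R f_ f M) => // n0; case: (bf n0).
  apply: (vC.2 (fun n0 => on_pair (f_ n0) (fun=> \int[Pr]_w f_ n0 w)) _ M).
  - by move=> n0; case: (bf n0).
  - move=> n0 [w|w] /=; first exact: fM.
    exact: (Rintegral_bound (probability_setT Pr) (b n0) (fM n0)).
  - by move=> [w|w] /=; [exact: cf|exact: (Rintegral_cvg Prfin b fM cf)].
move=> A mA; have gA : genealogy (children S i) (position S i) setT A by exact: mA.
split; [exact: bmf_indic|exact/bmf_indic/(mgen i)|].
apply: mvclosure_sub; exists A => //; apply/funext => -[w|w] //=.
by rewrite Rintegral_indic//; exact: (mgen i).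
Qed.

End particle_system.

(** If p_0 = 0 then p_j <= j p_j for every j, and summation gives 1 <= m. *)
Lemma subcritical_extinction (R : realType) (p : probability nat R) :
  (offspring_mean p < 1)%E -> 0 < fine (p [set 0%N]).
Proof.
move=> m1; rewrite lt_neqAle fine_ge0// andbT; apply/eqP => p0.
have p00 : p [set 0%N] = 0%E by rewrite -[LHS]fineK ?fin_num_measure// -p0.
move: m1; rewrite ltNge => /negP; apply.
rewrite -(probability_setT p) (_ : setT = \bigcup_j [set j]); last first.
  by apply/seteqP; split => // j _; exists j.
rewrite measure_bigcup//; last first.
  apply/trivIsetP => i j _ _ ij; apply/seteqP; split => // k [/= -> /eqP].
  by rewrite (negbTE ij).
rewrite /offspring_mean (eq_eseriesl (Q := xpredT)); last first.
  by move=> i; rewrite in_setT.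
apply: lee_nneseries => // j _.
case: j => [|j].
  by rewrite mul0e; apply: (@le_trans _ _ (p [set 0%N])) => //; rewrite p00.
by apply: lee_pemull => //; rewrite lee_fin ler1n.
Qed.

(** * The chain started from a point measure, and its mixture under [Q] *)

Section chain.
Context d (Omega : measurableType d) (R : realType) (S : particleSystem Omega R)
  (p : probability nat R) (P : R.-pker (measurableTypeR R) ~> (measurableTypeR R))
  (Prob : nzPointMeasure R -> probability Omega R).
Hypothesis hmean : (offspring_mean p < 1)%E.
Hypothesis hchain : forall mu : nzPointMeasure R,
  branching_Markov_chain S p P (nz_val mu) (Prob mu).
Notation TR := (measurableTypeR R).
Notation step := (offspring_map p P).

Let p0 : 0 < fine (p [set 0%N]) := subcritical_extinction hmean.

Lemma population_atoms n w : population S n w = pm_of_seq (atoms S n w).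
Proof. by []. Qed.

Lemma expectation_atomsS (h : TR -> R) mu n : measurable_fun [set: TR] h ->
  (forall y, 0 <= h y <= 1) ->
  \int[Prob mu]_w (\prod_(x <- atoms S n.+1 w) h x) =
  \int[Prob mu]_w (\prod_(x <- atoms S n w) step h x).
Proof.
move=> mh h01; have [s [_ Hanc Hbr Hind]] := hchain mu.
rewrite (expectation_prod_atoms mh h01 Hanc Hind).
rewrite (expectation_prod_atoms (measurable_offspring_map p P mh h01)
  (offspring_map_01 p P mh h01) Hanc Hind).
apply: eq_big_seq => i; rewrite mem_iota add0n => /Hbr hbr.
apply: (expectation_prod_generationS _ _ hbr) => //; exact: measurable_funPT.
Qed.

(** Read off the chain: [branching_Markov_chain] started from a nonzero [mu] lists its atoms. *)
Lemma point_measure_atomic (mu : pointMeasure R) : exists s, mu = pm_of_seq s.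
Proof.
have [->|/nz_val_surj[nu <-]] := pselect (mu = null_pm R); first by exists [::].
by have [s [-> _ _ _]] := hchain nu; exists s.
Qed.

(** The generating function is at least p_0 > 0 on [0, 1], which bounds the image away from 0 even
    where [h] vanishes. *)
Lemma V0_step (h : TR -> R) : measurable_fun [set: TR] h ->
  (forall y, 0 <= h y <= 1) -> V0 (step h).
Proof.
move=> mh h01; apply: (V0_intro (e := fine (p [set 0%N]))) => //.
  exact: measurable_offspring_map.
move=> y; have /andP[_ ->] := offspring_map_01 p P mh h01 y; rewrite andbT.
by apply: offspring_gf_ge; exact: pker_01.
Qed.

Let V0_step' (h : R -> R) : V0 h -> V0 (step h).
Proof. by move=> Vh; apply: V0_step; [exact: (V0_bounds Vh).1|exact: (V0_01 Vh)]. Qed.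

Lemma expectation_exp_logS (h : R -> R) mu n : V0 h ->
  \int[Prob mu]_w exp_log (population S n.+1 w) h =
  \int[Prob mu]_w exp_log (population S n w) (step h).
Proof.
move=> Vh; under eq_Rintegral do rewrite population_atoms exp_log_seq//.
under [RHS]eq_Rintegral do rewrite population_atoms (exp_log_seq _ (V0_step' Vh)).
by apply: expectation_atomsS; [exact: (V0_bounds Vh).1|exact: (V0_01 Vh)].
Qed.

Lemma expectation_exp_log0 (h : R -> R) mu : V0 h ->
  \int[Prob mu]_w exp_log (population S 0 w) h = exp_log (nz_val mu) h.
Proof.
move=> Vh; have [s [-> Hanc Hbr Hind]] := hchain mu.
under eq_Rintegral do rewrite population_atoms exp_log_seq//.
have [mh _] := V0_bounds Vh; have h01 := V0_01 Vh.
rewrite (expectation_prod_atoms mh h01 Hanc Hind) exp_log_seq// [RHS](big_nth 0).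
rewrite /index_iota subn0; apply: eq_big_seq => i; rewrite mem_iota add0n => /Hbr[hx _].
transitivity (\int[Prob mu]_w h (nth 0 s i)).
  apply: ae_eq_Rintegral; [exact: bmf_tree_prod|exact: bmf_cst|].
  by apply: filterS hx => w /= <-; rewrite /tree_prod big_seq1.
exact/Rintegral_cst1/probability_setT.
Qed.

Lemma offspring_pgflE (h : R -> R) : V0 h -> offspring_pgfl S Prob h = step h.
Proof.
move=> Vh; apply/funext => x.
rewrite /offspring_pgfl expectation_exp_logS// expectation_exp_log0;
  last exact: V0_step'.
by rewrite exp_log_seq ?big_seq1//; exact: V0_step'.
Qed.

(** Each use of the branching property lowers the generation and replaces [h] by [step h]; at
    generation 0 the expectation is an explicit measurable function of [mu]. *)
Lemma measurable_expectation_exp_log (h : R -> R) n : V0 h ->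
  measurable_fun [set: nzPointMeasure R]
    (fun mu => \int[Prob mu]_w exp_log (population S n w) h).
Proof.
elim: n h => [|n ih] h Vh.
  by under eq_fun do rewrite expectation_exp_log0//; exact: measurable_exp_log.
by under eq_fun do rewrite expectation_exp_logS//; exact: (ih _ (V0_step' Vh)).
Qed.

Lemma bmf_exp_log_population (h : R -> R) n : V0 h ->
  bmf (fun w => exp_log (population S n w) h).
Proof.
move=> Vh; under eq_fun do rewrite population_atoms exp_log_seq//.
by apply: bmf_prod_atoms; [exact: (V0_bounds Vh).1|exact: (V0_01 Vh)].
Qed.

Lemma population_size_gt0 n w :
  (0 < population_size S n w)%E <-> population S n w <> null_pm R.
Proof.
have nE : pm_count setT (null_pm R) = 0%N by rewrite pm_count_seq.
rewrite /population_size pm_countE// lte_fin ltr0n lt0n; split.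
  by move=> /eqP h /(congr1 (pm_count setT)); rewrite nE.
move=> h; apply/eqP => h0; apply: h; rewrite population_atoms.
move: h0; rewrite population_atoms pm_count_seq// => h0; congr pm_of_seq.
apply: size0nil; rewrite -h0.
by apply/esym/eqP; rewrite -all_count; apply/allP => ? _; rewrite inE.
Qed.

Section laws.
Variable Q : probability (nzPointMeasure R) R.

Let Qfin : (Q setT < +oo)%E.
Proof. exact/total_mass1_fin/probability_setT. Qed.

Let Probfin mu : (Prob mu setT < +oo)%E.
Proof. exact/total_mass1_fin/probability_setT. Qed.

Definition mean_after n (f : PM R -> R) (mu : nzPointMeasure R) :=
  \int[Prob mu]_w f (population S n w).

Definition law_after n (f : PM R -> R) := \int[Q]_mu mean_after n f mu.

(** What makes the three integrals of [f], under [Q], under [Prob mu] and under the mixture, linear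
    and continuous in [f]. For indicators the last condition is the measurability in [mu] of the
    probability of an event. *)
Definition regular_after n (f : PM R -> R) :=
  [/\ bmf (fun mu => f (nz_val mu)), bmf (fun w => f (population S n w)) &
    bmf (mean_after n f)].

Lemma mvclass_regular_after n : mvclass (regular_after n).
Proof.
split=> [a f g [f1 f2 f3] [g1 g2 g3]|f_ f M H fM cf].
  split; [exact: (bmf_lin a f1 g1)|exact: (bmf_lin a f2 g2)|].
  have := bmf_lin a f3 g3; congr bmf; apply/funext => mu.
  by rewrite /mean_after (Rintegral_lin (Probfin mu)).
have H2 k : bmf (fun w => f_ k (population S n w)) by case: (H k).
split.
- by apply: (@bmf_lim _ _ _ (fun k mu => f_ k (nz_val mu)) _ M) => // k; case: (H k).
- exact: (@bmf_lim _ _ _ (fun k w => f_ k (population S n w)) _ M).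
- apply: (@bmf_lim _ _ _ (fun k mu => mean_after n (f_ k) mu) _ M) => [k|k mu|mu].
  + by case: (H k).
  + by apply: (Rintegral_bound (probability_setT (Prob mu)) (H2 k)) => w; exact: fM.
  + exact: (@Rintegral_cvg _ _ _ _ (Probfin mu) _ _ M).
Qed.

Lemma regular_after_exp_log n (h : R -> R) : V0 h ->
  regular_after n (fun mu => exp_log (mu : pointMeasure R) h).
Proof.
move=> Vh; split.
- apply: bmf_01; first exact: measurable_exp_log.
  by move=> mu; exact: exp_log_01.
- exact: bmf_exp_log_population.
- apply: bmf_01; first exact: measurable_expectation_exp_log.
  move=> mu; apply: (Rintegral_01 (probability_setT (Prob mu))).
    exact: bmf_exp_log_population.
  by move=> w; exact: exp_log_01.
Qed.

Lemma regular_after_indic n (C : set (PM R)) : measurable C -> regular_after n \1_C.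
Proof.
apply: mvclass_count_events; first exact: mvclass_regular_after.
exact: regular_after_exp_log.
Qed.

Lemma law_after_lin n a f g : regular_after n f -> regular_after n g ->
  law_after n (fun mu => a * f mu + g mu) = a * law_after n f + law_after n g.
Proof.
move=> [_ f2 f3] [_ g2 g3]; rewrite -(Rintegral_lin Qfin a f3 g3).
apply: eq_Rintegral => mu _; exact: (Rintegral_lin (Probfin mu)).
Qed.

(** The law of Z_n under the mixture is compared with a Q + (1 - a) \delta_0 by means of test
    functions. The class is used both ways: from generating functionals to events, and from events
    to generating functionals. *)
Lemma mvclass_law_after n a : mvclass [set f | regular_after n f /\
  law_after n f = a * \int[Q]_mu f (nz_val mu) + (1 - a) * f (null_pm R)].
Proof.
have [vl vc] := mvclass_regular_after n.
split=> [b f g [rf fE] [rg gE]|f_ f M H fM cf].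
  split; first exact: vl.
  have [f1 _ _] := rf; have [g1 _ _] := rg.
  by rewrite law_after_lin// (Rintegral_lin Qfin b f1 g1) fE gE; ring.
have r k : regular_after n (f_ k) by case: (H k).
split; first by apply: (vc f_ f M).
have c1 : (fun k => law_after n (f_ k)) @ \oo --> law_after n f.
  apply: (@Rintegral_cvg _ _ _ _ Qfin _ _ M) => [k|k mu|mu].
  - by case: (r k).
  - have [_ rk _] := r k.
    by apply: (Rintegral_bound (probability_setT (Prob mu)) rk) => w; exact: fM.
  - by apply: (@Rintegral_cvg _ _ _ _ (Probfin mu) _ _ M) => // k; case: (r k).
have c2 : (fun k => law_after n (f_ k)) @ \oo -->
    a * \int[Q]_mu f (nz_val mu) + (1 - a) * f (null_pm R).
  rewrite (_ : (fun k => _) = fun k =>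
    a * \int[Q]_mu f_ k (nz_val mu) + (1 - a) * f_ k (null_pm R)); last first.
    by apply/funext => k; case: (H k).
  apply: cvgD; apply: cvgM; [exact: cvg_cst| |exact: cvg_cst|exact: cf].
  by apply: (@Rintegral_cvg _ _ _ _ Qfin _ _ M) => // k; case: (r k).
exact: (@norm_cvg_unique _ _ _ _ _ _ c1 c2).
Qed.

Lemma mixture_law_after n (C : set (PM R)) : measurable C ->
  fine (mixture Prob Q [set w | C (population S n w)]) = law_after n \1_C.
Proof.
move=> mC; have [_ [mi _] _] := regular_after_indic n mC.
have mE : measurable [set w | C (population S n w)].
  by apply/(measurable_indicP R); exact: mi.
rewrite /mixture /law_after /mean_after; congr fine; apply: eq_integral => mu _.
transitivity ((\int[Prob mu]_w \1_[set w | C (population S n w)] w)%:E); last by [].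
by rewrite Rintegral_indic// fineK// fin_num_measure.
Qed.

End laws.

End chain.

(** * Quasi-stationary distributions *)

(** A nonnegative function with integral 0 vanishes almost everywhere; for a positive one the whole
    space would be negligible. *)
Lemma Rintegral_gt0 d (T : measurableType d) (R : realType)
    (Q : probability T R) (f : T -> R) :
  measurable_fun [set: T] f -> (forall x, 0 < f x <= 1) -> 0 < \int[Q]_x f x.
Proof.
move=> mf f01; have bf : bmf f.
  by apply: bmf_01 => // x; have /andP[/ltW -> ->] := f01 x.
rewrite lt_neqAle Rintegral_ge0 => [|x _]; last by case/andP: (f01 x) => /ltW.
rewrite andbT eq_sym; apply/eqP => f0.
have : (\int[Q]_x `|(f x)%:E| = 0)%E.
  have fin := integrable_fin_num measurableT
    (bmf_integrable (total_mass1_fin (probability_setT Q)) bf).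
  under eq_integral do rewrite abse_EFin ger0_norm ?(ltW (proj1 (andP (f01 _))))//.
  by rewrite -[LHS]fineK ?fin//; congr EFin.
have mf' : measurable_fun setT (EFin \o f) by exact/measurable_EFinP.
move=> /(ae_eq_integral_abs Q measurableT mf')[N [mN QN0 sN]].
have /eqP := probability_setT Q; rewrite (_ : setT = N) ?QN0 ?eqe 1?eq_sym ?oner_eq0//.
apply/seteqP; split => // x _; apply: sN => /= /(_ Logic.I)[] fx0.
by have := f01 x; rewrite fx0 ltxx.
Qed.

Section qsd.
Context d (Omega : measurableType d) (R : realType) (S : particleSystem Omega R)
  (p : probability nat R) (P : R.-pker (measurableTypeR R) ~> (measurableTypeR R))
  (Prob : nzPointMeasure R -> probability Omega R).
Hypothesis hmean : (0 < offspring_mean p < 1)%E.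
Hypothesis hchain : forall mu : nzPointMeasure R,
  branching_Markov_chain S p P (nz_val mu) (Prob mu).
Variable Q : probability (nzPointMeasure R) R.

Let m1 : (offspring_mean p < 1)%E. Proof. by case/andP: hmean. Qed.

Let alive : set (PM R) := ~` [set null_pm R].

Let m_alive : measurable alive.
Proof. by apply: measurableC; exact: (null_count_measurable (point_measure_atomic hchain)). Qed.

Let aliveE : alive = @nz_val R @` setT.
Proof.
apply/seteqP; split => [mu /nz_val_surj[nu <-]|_ [nu _ <-]]; first by exists nu.
exact: nz_val_neq0.
Qed.

Let law := law_after S Prob Q.

(** The image of [B] does not contain the null measure, so the intersection with survival
    disappears. *)
Lemma quasi_stationaryE : quasi_stationary S Prob Q <->
  forall n B, measurable B ->
    law n \1_(@nz_val R @` B : set (PM R)) / law n \1_alive = fine (Q B).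
Proof.
suff E n B : measurable B ->
    fine (mixture Prob Q ([set w | (@nz_val R @` B) (population S n w)] `&`
      [set w | (0 < population_size S n w)%E])) /
    fine (mixture Prob Q [set w | (0 < population_size S n w)%E]) =
    law n \1_(@nz_val R @` B : set (PM R)) / law n \1_alive.
  by split=> qs n B mB; [rewrite -E//; exact: qs|rewrite /= E//; exact: qs].
move=> mB; have mB' := nz_image_measurable (point_measure_atomic hchain) mB.
rewrite /law -(mixture_law_after m1 hchain Q n m_alive).
rewrite -(mixture_law_after m1 hchain Q n mB').
have -> : [set w | (0 < population_size S n w)%E] = [set w | alive (population S n w)].
  by apply/seteqP; split => w /population_size_gt0.
by rewrite setIidl// => w [mu _ muE] /=; rewrite /alive -muE; exact: nz_val_neq0.
Qed.

Lemma pgfl_step (h : R -> R) : V0 h ->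
  pgfl Q (offspring_pgfl S Prob h) =
  law 1 (fun mu => exp_log (mu : pointMeasure R) h).
Proof.
move=> Vh; rewrite (offspring_pgflE m1 hchain Vh); apply: eq_Rintegral => mu _.
rewrite /mean_after (expectation_exp_logS m1 hchain _ _ Vh).
rewrite (expectation_exp_log0 hchain)//.
exact: (V0_step P m1 (V0_bounds Vh).1 (V0_01 Vh)).
Qed.

(** The product of the function 0 over the first generation is the indicator of extinction, and one
    step maps 0 to the constant f(0). As 0 is not in [V0], the step is made with products over
    [atoms]. *)
Lemma law_extinct : law 1 \1_([set null_pm R] : set (PM R)) =
  pgfl Q (fun=> offspring_gf p 0).
Proof.
apply: eq_Rintegral => mu _; rewrite /mean_after.
have mz : measurable_fun [set: measurableTypeR R] (fun=> 0 : R) by exact: measurable_cst.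
have z01 (y : measurableTypeR R) : 0 <= (0 : R) <= 1 by rewrite lexx ler01.
have stepE : offspring_map p P (fun=> 0) = fun=> offspring_gf p 0.
  apply/funext => y; congr (offspring_gf p _).
  exact: (Rintegral_cst1 (prob_kernel (s := P) y)).
have V := V0_step P m1 mz z01; rewrite stepE in V.
rewrite -(expectation_exp_log0 hchain _ V).
transitivity (\int[Prob mu]_w
    \prod_(x <- atoms S 0 w) offspring_map p P (fun=> 0) x); last first.
  by apply: eq_Rintegral => w _; rewrite population_atoms (exp_log_seq _ V) stepE.
rewrite -(expectation_atomsS hchain mu 0 mz z01); apply: eq_Rintegral => w _.
rewrite indicE population_atoms.
case: (atoms S 1 w) => [|x l]; first by rewrite big_nil mem_set.
rewrite big_cons mul0r memNset//= => /(congr1 (pm_count setT)).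
by rewrite !pm_count_seq//= in_setT.
Qed.

Lemma pgfl_1 : pgfl Q (fun=> 1) = 1.
Proof.
rewrite /pgfl; under eq_Rintegral do rewrite exp_log_1.
exact/Rintegral_cst1/probability_setT.
Qed.

Lemma exp_log_null (h : R -> R) : V0 h -> exp_log (null_pm R) h = 1.
Proof. by move=> Vh; rewrite exp_log_seq// big_nil. Qed.

Lemma pgfl_imp_quasi_stationary (r : R) : 0 < r ->
  (forall h : R -> R, V0 h ->
    pgfl Q (offspring_pgfl S Prob h) - pgfl Q (fun=> offspring_gf p 0) =
    r * pgfl Q h) ->
  quasi_stationary S Prob Q.
Proof.
move=> r0 eqQ; apply/quasi_stationaryE => n.
have V1 : V0 (fun _ : R => 1) by exact: V0_1.
have E0 : pgfl Q (fun=> offspring_gf p 0) = 1 - r.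
  have := eqQ _ V1; rewrite pgfl_1 mulr1 => <-.
  rewrite (offspring_pgflE m1 hchain V1) (_ : offspring_map p P (fun=> 1) = fun=> 1).
    by rewrite pgfl_1 subKr.
  apply/funext => y; rewrite -[RHS](offspring_gf1 p); congr (offspring_gf p _).
  exact: (Rintegral_cst1 (prob_kernel (s := P) y)).
have Eexp : forall h : R -> R, V0 h -> law n (fun mu => exp_log (mu : pointMeasure R) h) =
    r ^+ n * pgfl Q h + (1 - r ^+ n).
  elim: n => [|n ih] h Vh.
    rewrite expr0 subrr addr0 mul1r; apply: eq_Rintegral => mu _.
    exact: (expectation_exp_log0 hchain).
  have Vs := V0_step P m1 (V0_bounds Vh).1 (V0_01 Vh).
  transitivity (law n (fun mu => exp_log (mu : pointMeasure R) (offspring_map p P h))).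
    by apply: eq_Rintegral => mu _; exact: (expectation_exp_logS m1 hchain).
  (* The equation reads G_Q[G[h]] = r G_Q[h] + 1 - r, to be inserted in r^n G_Q[G[h]] + 1 - r^n. *)
  rewrite ih//; have := eqQ h Vh; rewrite (offspring_pgflE m1 hchain Vh) E0.
  move=> /eqP; rewrite subr_eq => /eqP ->; rewrite exprS; ring.
have law_indic C : measurable C -> law n \1_C =
    r ^+ n * \int[Q]_mu \1_C (nz_val mu) + (1 - r ^+ n) * \1_C (null_pm R).
  move=> mC; have := mvclass_count_events (mvclass_law_after S Prob Q n (r ^+ n)) _ mC.
  case=> // h Vh; split; first exact: (regular_after_exp_log m1 hchain).
  by rewrite exp_log_null// mulr1; exact: Eexp.
have law_image B : measurable B ->
    law n \1_(@nz_val R @` B : set (PM R)) = r ^+ n * fine (Q B).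
  move=> mB; rewrite law_indic; last exact: (nz_image_measurable (point_measure_atomic hchain)).
  rewrite [X in _ + _ * X](_ : _ = 0) ?mulr0 ?addr0; last first.
    by rewrite indicE memNset// => -[mu _]; exact: nz_val_neq0.
  congr (_ * _); rewrite -Rintegral_indic//; apply: eq_Rintegral => mu _.
  rewrite !indicE; congr (_%:R); congr nat_of_bool.
  apply/idP/idP => /set_mem Bmu; apply/mem_set; last by exists mu.
  by have [nu Bnu /nz_val_inj <-] := Bmu.
(* Survival is the image of the whole space, hence has probability r^n, which cancels in the
   quotient. *)
move=> B mB; rewrite law_image// aliveE law_image// probability_setT mulr1.
by rewrite mulrC mulKf// expf_neq0// lt0r_neq0.
Qed.

Lemma quasi_stationary_imp_pgfl : quasi_stationary S Prob Q ->
  exists2 r : R, 0 < r < 1 & forall h : R -> R, V0 h ->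
    pgfl Q (offspring_pgfl S Prob h) - pgfl Q (fun=> offspring_gf p 0) =
    r * pgfl Q h.
Proof.
move=> /quasi_stationaryE /(_ 1%N) qs; set r := law 1 \1_alive in qs.
(* Division by 0 yields 0, whereas the quotient for the whole space must be 1. *)
have r_neq0 : r != 0.
  apply/eqP => r0; have := qs setT measurableT.
  by rewrite -aliveE -/r r0 mul0r probability_setT => /esym/eqP; rewrite oner_eq0.
have law_image B : measurable B ->
    law 1 \1_(@nz_val R @` B : set (PM R)) = r * fine (Q B).
  by move=> mB; rewrite -(qs B mB) mulrC divfK.
have reg C : measurable C -> regular_after S Prob 1 \1_C.
  exact: (regular_after_indic m1 hchain).
have m_null : measurable ([set null_pm R] : set (PM R)).
  exact: (null_count_measurable (point_measure_atomic hchain)).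
have one : regular_after S Prob 1 (fun=> 1).
  have := reg _ (@measurableT _ (PM R)); congr regular_after.
  by apply/funext => mu; rewrite indicT.
have nullE : law 1 \1_([set null_pm R] : set (PM R)) = 1 - r.
  rewrite (_ : \1_[set null_pm R] = fun mu : PM R => -1 * \1_alive mu + 1); last first.
    apply/funext => mu; rewrite !indicE in_setC.
    by case: (mu \in _) => /=; rewrite ?mulr0 ?mulr1 ?add0r ?addNr.
  rewrite /law law_after_lin//; last exact: reg.
  rewrite -/law -/r mulN1r addrC; congr (_ - _).
  transitivity (\int[Q]_mu (1 : R)).
    apply: eq_Rintegral => mu _; exact/Rintegral_cst1/probability_setT.
  exact/Rintegral_cst1/probability_setT.
have law_indic C : measurable C -> law 1 \1_C =
    r * \int[Q]_mu \1_C (nz_val mu) + (1 - r) * \1_C (null_pm R).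
  (* [C] splits into the image of [B] and possibly the null measure. That [B] is Borel is the first
     condition in the regularity of the indicator of [C]. *)
  move=> mC; pose B := @nz_val R @^-1` C.
  have mB : measurable B.
    by apply/(measurable_indicP R); have [[]] := reg C mC.
  have -> : \int[Q]_mu \1_C (nz_val mu) = fine (Q B) by rewrite -Rintegral_indic.
  rewrite -law_image// -nullE addrC mulrC -law_after_lin; last 2 first.
  - exact: reg.
  - exact: (reg _ (nz_image_measurable (point_measure_atomic hchain) mB)).
  congr (law 1 _); apply/funext => mu; rewrite !indicE.
  have [->|mu0] := pselect (mu = null_pm R).
    rewrite (mem_set (erefl : [set null_pm R] (null_pm R))) mulr1.
    rewrite (_ : (null_pm R \in @nz_val R @` B) = false) ?addr0//.
    by apply: memNset => -[nu _]; exact: nz_val_neq0.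
  rewrite (_ : (mu \in [set null_pm R]) = false); last exact: memNset.
  rewrite mulr0 add0r; congr (_%:R); congr nat_of_bool.
  have [nu <-] := nz_val_surj mu0.
  apply/idP/idP => /set_mem Cnu; apply/mem_set; first by exists nu.
  by have [nu' Cnu' <-] := Cnu.
have law_exp (h : R -> R) : V0 h ->
    law 1 (fun mu => exp_log (mu : pointMeasure R) h) = r * pgfl Q h + (1 - r).
  move=> Vh.
  have [_ E] := mvclass_bmf (mvclass_law_after S Prob Q 1 r)
    (fun C mC => conj (reg C mC) (law_indic C mC))
    (bmf_01 (measurable_exp_log_count Vh) (fun mu => exp_log_01 mu Vh)).
  by rewrite /law E exp_log_null// mulr1.
exists r.
  rewrite lt_neqAle eq_sym r_neq0 Rintegral_ge0 => [|mu _]; last first.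
    by apply: Rintegral_ge0 => w _; rewrite indicE.
  (* Here 1 - r is G_Q[f(0)], the integral of a positive function because f(0) = p_0 > 0. *)
  rewrite /= -subr_gt0 -nullE law_extinct; have V : V0 (fun _ : R => offspring_gf p 0).
    have := offspring_gf_01 p (_ : 0 <= (0 : R) <= 1).
    rewrite lexx ler01 => /(_ isT) g01.
    apply: (V0_intro (e := offspring_gf p 0)); first exact: measurable_cst.
      by rewrite offspring_gf0; exact: subcritical_extinction.
    by move=> _; case/andP: g01 => _ ->; rewrite lexx.
  apply: Rintegral_gt0; first exact: measurable_exp_log.
  by move=> mu; rewrite expR_gt0; case/andP: (exp_log_01 (nz_val mu) V).
by move=> h Vh; rewrite pgfl_step// law_exp// -law_extinct nullE addrK.
Qed.

End qsd.

Unset Implicit Arguments.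

Theorem proposition2p11 (R : realType)
    (p : probability nat R)
    (P : R.-pker (measurableTypeR R) ~> (measurableTypeR R))
    (d : measure_display) (Omega : measurableType d)
    (S : particleSystem Omega R)
    (Prob : nzPointMeasure R -> probability Omega R)
    (hmean : (0 < offspring_mean p < 1)%E)
    (hchain : forall mu : nzPointMeasure R,
      branching_Markov_chain S p P (nz_val mu) (Prob mu))
    (Q : probability (nzPointMeasure R) R) :
  quasi_stationary S Prob Q <->
  exists2 alpha : R, 0 < alpha &
    forall h : R -> R, V0 h ->
      pgfl Q (offspring_pgfl S Prob h) - pgfl Q (fun=> offspring_gf p 0) =
      fine (offspring_mean p) `^ alpha * pgfl Q h.
Proof.
have [m0 m1] := andP hmean.
have mfin : offspring_mean p \is a fin_num.
  by rewrite ge0_fin_numE ?ltW// (lt_trans m1)// ltry.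
have f0 : 0 < fine (offspring_mean p) by rewrite fine_gt0// m0 (lt_trans m1) ?ltry.
have f1 : fine (offspring_mean p) < 1 by rewrite -lte_fin fineK.
split=> [/(quasi_stationary_imp_pgfl hmean hchain)[r /andP[r0 r1] eqQ]|[alpha a0]].
  exists (ln r / ln (fine (offspring_mean p))).
    by rewrite nmulr_rgt0 ?invr_lt0 ?ln_lt0// ?r0 ?f0.
  move=> h Vh; rewrite eqQ//; congr (_ * _).
  by rewrite /powR gt_eqF// divfK ?lnK// lt_eqF// ln_lt0// f0.
by apply: (pgfl_imp_quasi_stationary hmean hchain); rewrite powR_gt0.
Qed.
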